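(* Let $E$ and $F$ be full Hilbert $C^*$-modules over $C^*$-algebras $A$ and $B$, respectively, and let $T:E\to F$ be a surjective linear 2-isometry. Then $T$ preserves the inner products and is a module map with respect to some $*$-isomorphism of the underlying $C^*$-algebras; that is, there exists a $*$-isomorphism $\varphi$ from $A$ onto $B$ such that $$\langle Tx,Ty\rangle=\varphi(\langle x,y\rangle)\quad\text{and}\quad T(xa)=T(x)\varphi(a)$$ for all $x,y\in E$ and all $a\in A$.
   Context: A (right) Hilbert $C^*$-module over a $C^*$-algebra $A$ is a right $A$-module $E$ (a complex vector space with compatible action) equipped with an $A$-valued (positive definite) inner product $\langle\cdot,\cdot\rangle$ which is conjugate $A$-linear in the first variable (so $\langle xa,y\rangle=a^*\langle x,y\rangle$) and $A$-linear in the second variable ($\langle x,ya\rangle=\langle x,y\rangle a$), such that $E$ is a Banach space with respect to the norm $\|x\|=\|\langle x,x\rangle\|^{1/2}$. $\langle E,E\rangle$ denotes the linear span in $A$ of the elements $\langle x,y\rangle$, $x,y\in E$. $E$ is called full if the closed two-sided ideal $\overline{\langle E,E\rangle}$ (norm closure) equals $A$. For a positive integer $n$, $M_n(E)$ is the space of $n\times n$ matrices with entries in $E$, normed by its natural structure of Hilbert $C^*$-module over $M_n(A)$, with inner product $\langle (x_{ij}),(y_{ij})\rangle=\big(\sum_k\langle x_{ki},y_{kj}\rangle\big)_{ij}$ (equivalently, the operator norm obtained when $E$ is identified with a norm-closed ternary ring of operators). For a linear map $T:E\to F$, $T^{(n)}:M_n(E)\to M_n(F)$ is defined by $T^{(n)}((x_{ij}))=(T(x_{ij}))$.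 $T$ is called an $n$-isometry if $T^{(n)}$ is isometric; thus a 2-isometry is a map $T$ for which $T^{(2)}$ is isometric. *)

(* Defs.v *)
From HB Require Import structures.
From mathcomp Require Import all_boot all_order all_algebra.
From mathcomp Require Import complex.
From mathcomp Require Import all_classical all_reals all_analysis.

Set Implicit Arguments.
Unset Strict Implicit.
Unset Printing Implicit Defensive.

Import Order.TTheory GRing.Theory Num.Theory.
Import numFieldNormedType.Exports.

Local Open Scope classical_set_scope.
Local Open Scope complex_scope.
Local Open Scope ring_scope.

(* C*-algebras are not assumed unital, hence the multiplication is not that of
   a MathComp ring. Norms of normed spaces over R[i] take values in R[i]. *)
HB.mixin Record isCstarAlgebra (R : realType) A
    of CompleteNormedModule R[i] A := {
  cmul : A -> A -> A ;
  cstar : A -> A ;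
  cmulA : associative cmul ;
  cmulDl : left_distributive cmul +%R ;
  cmulDr : right_distributive cmul +%R ;
  cmulZl : forall (c : R[i]) a b, cmul (c *: a) b = c *: cmul a b ;
  cmulZr : forall (c : R[i]) a b, cmul a (c *: b) = c *: cmul a b ;
  cstarK : involutive cstar ;
  cstarD : {morph cstar : a b / a + b} ;
  cstarZ : forall (c : R[i]) a, cstar (c *: a) = (c^*)%R *: cstar a ;
  cstarM : forall a b, cstar (cmul a b) = cmul (cstar b) (cstar a) ;
  norm_cmul_le : forall a b, `|cmul a b| <= `|a| * `|b| ;
  norm_cstar_cmul : forall a, `|cmul (cstar a) a| = `|a| ^+ 2
}.

#[short(type="cstarAlgType")]
HB.structure Definition CstarAlgebra (R : realType) :=
  { A of isCstarAlgebra R A & CompleteNormedModule R[i] A }.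

Definition cpositive (R : realType) (A : cstarAlgType R) (a : A) : Prop :=
  exists b : A, a = cmul (cstar b) b.

HB.mixin Record isHilbertModule (R : realType) (A : cstarAlgType R) E
    of CompleteNormedModule R[i] E := {
  act : E -> A -> E ;
  inner : E -> E -> A ;
  actDl : forall x y a, act (x + y) a = act x a + act y a ;
  actDr : forall x a b, act x (a + b) = act x a + act x b ;
  actM : forall x a b, act x (cmul a b) = act (act x a) b ;
  actZl : forall (c : R[i]) x a, act (c *: x) a = c *: act x a ;
  actZr : forall (c : R[i]) x a, act x (c *: a) = c *: act x a ;
  innerDr : forall x y z, inner x (y + z) = inner x y + inner x z ;
  innerZr : forall (c : R[i]) x y, inner x (c *: y) = c *: inner x y ;
  inner_actr : forall x y a, inner x (act y a) = cmul (inner x y) a ;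
  inner_sym : forall x y, cstar (inner x y) = inner y x ;
  inner_ge0 : forall x, cpositive (inner x x) ;
  inner_eq0 : forall x, inner x x = 0 -> x = 0 ;
  norm_inner : forall x, `|x| = sqrtC `|inner x x|
}.

#[short(type="hilbertModType")]
HB.structure Definition HilbertModule (R : realType) (A : cstarAlgType R) :=
  { E of isHilbertModule R A E & CompleteNormedModule R[i] E }.

Definition rnorm (R : realType) (V : normedModType R[i]) (x : V) : R :=
  complex.Re `|x|.

Definition lspan (K : numFieldType) (V : lmodType K) (S : set V) : set V :=
  [set v | exists (n : nat) (c : 'I_n -> K) (s : 'I_n -> V),
     (forall i, S (s i)) /\ v = \sum_(i < n) c i *: s i].

Definition full (R : realType) (A : cstarAlgType R) (E : hilbertModType A) :
    Prop :=
  closure (lspan [set inner p.1 p.2 | p in [set: E * E]]) = [set: A].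

Section MatrixNorms.
Context (R : realType) (A : cstarAlgType R) (n : nat).

(* The norm of the standard Hilbert A-module A^n. *)
Definition cvnorm (a : 'cV[A]_n) : R :=
  Num.sqrt (rnorm (\sum_(i < n) cmul (cstar (a i 0)) (a i 0))).

Definition cmulmxv (M : 'M[A]_n) (a : 'cV[A]_n) : 'cV[A]_n :=
  \col_i \sum_(j < n) cmul (M i j) (a j 0).

(* The C*-norm of M_n(A): operator norm of left multiplication on A^n. *)
Definition cmxnorm (M : 'M[A]_n) : R :=
  sup [set cvnorm (cmulmxv M a) | a in [set a | cvnorm a <= 1]].

Definition mxinner (E : hilbertModType A) (x y : 'M[E]_n) : 'M[A]_n :=
  \matrix_(i, j) \sum_(k < n) inner (x k i) (y k j).

Definition mxmodnorm (E : hilbertModType A) (x : 'M[E]_n) : R :=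
  Num.sqrt (cmxnorm (mxinner x x)).

End MatrixNorms.

Definition n_isometry (R : realType) (A B : cstarAlgType R)
    (E : hilbertModType A) (F : hilbertModType B) (n : nat)
    (T : {linear E -> F}) : Prop :=
  forall x : 'M[E]_n, mxmodnorm (map_mx T x) = mxmodnorm x.

Definition star_isomorphism (R : realType) (A B : cstarAlgType R)
    (phi : {linear A -> B}) : Prop :=
  [/\ bijective phi,
      forall a b, phi (cmul a b) = cmul (phi a) (phi b) &
      forall a, phi (cstar a) = cstar (phi a)].

(* Main.v *)
Require Import Defs.
From HB Require Import structures.
From mathcomp Require Import all_boot all_order all_algebra.
From mathcomp Require Import complex.
From mathcomp Require Import all_classical all_reals all_analysis.
From mathcomp Require Import ring lra zify.

Import Order.TTheory GRing.Theory Num.Theory.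
Import numFieldNormedType.Exports.

Local Open Scope ring_scope.

Set Implicit Arguments.
Unset Strict Implicit.
Unset Printing Implicit Defensive.

(* On the column module [E^2] the quadratic
   field [x |-> h - x <h, x>] is tangent to the unit sphere, and so is the
   pullback by [T] of the analogous field of [F^2]. Their difference is a
   homogeneous quadratic field [D]; by homogeneity the flow of [l D] stays in
   the ball for every complex [l], and Liouville's theorem, applied to Euler
   approximations that are polynomial in [l], forces [D = 0]. Only columns are
   needed: comparing second components yields
   [T (x <y, z>) = T x <T y, T z>]. Then [<x, y> |-> <T x, T y>] extends to a
   *-isomorphism, which is isometric by a spectral radius argument.

   Positivity in C*-algebras is obtained without functional calculus: [h] is
   positive when [|t - h| <= t] for some [t >= 0], which is visibly stable under
   sums, and square roots are limits of the iteration [z <- (k + z^2) / 2]. *)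

(** * Real-valued norms and completeness *)

(** On [E] alone, tangency would only give, by polarization, the symmetrized product
    [x <y, z> + z <y, x>], which matrix transposition also preserves. In a column the entries
    separate: for [h = (y, 0)] the second entry of [(z, x) <h, (z, x)>] is [x <y, z>] itself, and
    the 2-isometry makes [T] isometric on columns. Subtracting the two fields removes the constant
    term [h]. What remains is complex bilinear, which is what lets [l] be complex. Only second-order
    upper bounds on squared norms enter, so no flow has to be constructed; these bounds all come
    from dropping positive terms, hence the preliminary work on positivity. In the last part,
    extension by continuity needs a norm comparison between related elements of [A] and [B];
    fullness provides it, once for [T] and once for its inverse. *)

Section RealNorm.
Context {R : realType} {V : normedModType R[i]}.
Implicit Types x y : V.

Lemma rnormE x : `|x| = (rnorm x)%:C%C.
Proof.
rewrite /rnorm; case: `|x| (normr_ge0 x) => a b.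
by rewrite lecE /= => /andP[/eqP -> _].
Qed.

Lemma rnorm_ge0 x : 0 <= rnorm x.
Proof. by rewrite -lecR -rnormE; exact: normr_ge0. Qed.

Lemma rnorm0 : rnorm (0 : V) = 0.
Proof. by rewrite /rnorm normr0. Qed.

Lemma rnorm_eq0 x : rnorm x = 0 -> x = 0.
Proof. by move=> x0; apply/eqP; rewrite -normr_eq0 rnormE x0. Qed.

Lemma rnormN x : rnorm (- x) = rnorm x.
Proof. by rewrite /rnorm normrN. Qed.

Lemma rnormD x y : rnorm (x + y) <= rnorm x + rnorm y.
Proof. by rewrite -lecR rmorphD /= -!rnormE ler_normD. Qed.

Lemma rnormB x y : rnorm (x - y) <= rnorm x + rnorm y.
Proof. by rewrite -[rnorm y]rnormN rnormD. Qed.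

Lemma rnorm_distC x y : rnorm (x - y) = rnorm (y - x).
Proof. by rewrite -rnormN opprB. Qed.

Lemma rnormZ (c : R[i]) x : rnorm (c *: x) = rnorm (c : R[i]^o) * rnorm x.
Proof. by apply: complexI; rewrite rmorphM /= -!rnormE normrZ. Qed.

Lemma rnorm_sum (I : finType) (F : I -> V) :
  rnorm (\sum_i F i) <= \sum_i rnorm (F i).
Proof.
elim/big_ind2: _ => [|x a y b xa yb|//]; first by rewrite rnorm0.
exact: le_trans (rnormD _ _) (lerD xa yb).
Qed.

End RealNorm.

Section ComplexAbs.
Context {R : realType}.

Definition cabs (z : R[i]) : R := rnorm (z : R[i]^o).

Lemma cabsE z : `|z| = (cabs z)%:C%C.
Proof. exact: (@rnormE _ (R[i]^o)). Qed.

Lemma cabs_ge0 z : 0 <= cabs z. Proof. exact: rnorm_ge0. Qed.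

Lemma cabsM z w : cabs (z * w) = cabs z * cabs w.
Proof. exact: (@rnormZ _ (R[i]^o)). Qed.

Lemma cabsD z w : cabs (z + w) <= cabs z + cabs w.
Proof. exact: (@rnormD _ (R[i]^o)). Qed.

Lemma cabs_real (t : R) : cabs t%:C%C = `|t|.
Proof. by apply: complexI; rewrite -cabsE normc_def /= expr0n addr0 sqrtr_sqr. Qed.

Lemma cabs_nneg (t : R) : 0 <= t -> cabs t%:C%C = t.
Proof. by move=> t0; rewrite cabs_real ger0_norm. Qed.

Lemma cabs1 : cabs 1 = 1.
Proof. by rewrite -(cabs_nneg ler01). Qed.

Lemma cabs0 : cabs 0 = 0. Proof. exact: (@rnorm0 _ (R[i]^o)). Qed.

Lemma cabs_conj z : cabs (z^*)%R = cabs z.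
Proof. by apply: complexI; rewrite -!cabsE norm_conjC. Qed.

Lemma cabsX z n : cabs (z ^+ n) = cabs z ^+ n.
Proof. by elim: n => [|n IH]; rewrite ?expr0 ?cabs1 // !exprS cabsM IH. Qed.

Lemma cabs_Re z : `|complex.Re z| <= cabs z.
Proof. by rewrite -lecR -cabsE normc_ge_Re. Qed.

Lemma cabs_Im z : `|complex.Im z| <= cabs z.
Proof.
have := cabs_Re (- ('i%C * z)).
by rewrite [cabs _](@rnormN _ (R[i]^o)) -/(cabs _) cabsM; case: z => a b /=;
   rewrite !(mul0r, mul1r, sub0r, opprK) /cabs /rnorm normc_def /= expr0n expr1n add0r sqrtr1 mul1r.
Qed.

Lemma cabs_le_ReIm z : cabs z <= `|complex.Re z| + `|complex.Im z|.
Proof.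
rewrite [z in cabs z]complexE; apply: le_trans (cabsD _ _) _.
rewrite cabsM !cabs_real; have -> : cabs 'i%C = 1; last by rewrite mul1r.
by rewrite /cabs /rnorm normc_def /= expr0n expr1n add0r sqrtr1.
Qed.

End ComplexAbs.

Section Completeness.
Context {R : realType}.
Implicit Types e : nat -> R.

(** One index per threshold is enough: each use pairs [e] with a bound on all differences from index
    [n] on, or with an inequality valid for every [n]. *)
Definition vanishing e := forall eps : R, 0 < eps -> exists n, e n < eps.

Lemma vanishing_le0 e (x c : R) :
  vanishing e -> 0 <= c -> (forall n, x <= c * e n) -> x <= 0.
Proof.
move=> e0 c0 xe; rewrite leNgt; apply/negP => x0.
have c1 : 0 < c + 1 by apply: ltr_wpDl.
have [n] := e0 (x / (c + 1)) (divr_gt0 x0 c1).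
rewrite ltr_pdivlMr //; have := xe n; nra.
Qed.

Lemma rnorm_cauchy (V : completeNormedModType R[i]) (u : nat -> V) e :
    vanishing e -> (forall n m, (n <= m)%N -> rnorm (u m - u n) <= e n) ->
  exists l, forall n, rnorm (l - u n) <= e n.
Proof.
move=> e0 ue.
have : cvg (u @ \oo)%classic.
  apply/cauchy_cvgP/cauchy_exP => eps eps0.
  have [r0 rE] : 0 < complex.Re eps /\ eps = (complex.Re eps)%:C%C.
    by move: eps0; rewrite ltcE /=; case: eps => a b /= /andP[/eqP -> ->].
  move: (complex.Re eps) r0 rE => r r0 rE.
  have [n nr] := e0 r r0; exists (u n); exists n => // m /= nm.
  rewrite -ball_normE /= rnormE rE ltcR rnorm_distC.
  exact: le_lt_trans (ue _ _ nm) nr.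
set l := lim _ => ul; exists l => n; apply/ler_addgt0Pr => r r0.
have r0' : 0 < r%:C%C by rewrite ltcR.
have /cvgrPdist_lt ul' := ul; have [N _ Nr] := ul' _ r0'.
have := Nr (maxn N n) (leq_maxl _ _); rewrite /= rnormE ltcR => lr.
have := ue _ _ (leq_maxr N n); have := rnormD (l - u (maxn N n)) (u (maxn N n) - u n).
rewrite subrKA; lra.
Qed.

Lemma real_cauchy (u : nat -> R) e :
    vanishing e -> (forall n m, (n <= m)%N -> `|u m - u n| <= e n) ->
  exists l, forall n, `|l - u n| <= e n.
Proof.
move=> e0 ue.
have : cvg (u @ \oo)%classic.
  apply/cauchy_cvgP/cauchy_exP => r r0.
  have [n nr] := e0 r r0; exists (u n); exists n => // m /= nm.
  rewrite -ball_normE /= distrC.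
  exact: le_lt_trans (ue _ _ nm) nr.
set l := lim _ => ul; exists l => n; apply/ler_addgt0Pr => r r0.
have /cvgrPdist_lt ul' := ul; have [N _ Nr] := ul' _ r0.
have lr := Nr (maxn N n) (leq_maxl _ _); rewrite /= in lr.
have := ue _ _ (leq_maxr N n); have := ler_normD (l - u (maxn N n)) (u (maxn N n) - u n).
rewrite subrKA; lra.
Qed.

Lemma cabs_cauchy (u : nat -> R[i]) e :
    vanishing e -> (forall n m, (n <= m)%N -> cabs (u m - u n) <= e n) ->
  exists l, forall n, cabs (l - u n) <= 2 * e n.
Proof.
move=> e0 ue.
have [|a ha] := @real_cauchy (fun n => complex.Re (u n)) e e0.
  by move=> n m nm; apply: le_trans (ue _ _ nm); rewrite -raddfB cabs_Re.
have [|b hb] := @real_cauchy (fun n => complex.Im (u n)) e e0.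
  by move=> n m nm; apply: le_trans (ue _ _ nm); rewrite -raddfB cabs_Im.
exists (a +i* b)%C => n; apply: le_trans (cabs_le_ReIm _) _.
rewrite !raddfB /=; move: (ha n) (hb n); lra.
Qed.

End Completeness.

(** * The unitization of a C*-algebra *)

Section CstarBasics.
Context {R : realType} {A : cstarAlgType R}.
Implicit Types a b : A.

Lemma cmul0l b : cmul (0 : A) b = 0.
Proof. by rewrite -[X in cmul X b](scale0r (0 : A)) cmulZl scale0r. Qed.

Lemma cmul0r a : cmul a (0 : A) = 0.
Proof. by rewrite -[X in cmul a X](scale0r (0 : A)) cmulZr scale0r. Qed.

Lemma cstar0 : cstar (0 : A) = 0.
Proof. by rewrite -[X in cstar X](scale0r (0 : A)) cstarZ rmorph0 scale0r. Qed.

Lemma cstarN a : cstar (- a) = - cstar a.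
Proof. by apply/eqP; rewrite -addr_eq0 -cstarD addNr cstar0. Qed.

Lemma cstarB a b : cstar (a - b) = cstar a - cstar b.
Proof. by rewrite cstarD cstarN. Qed.

Lemma rnorm_cmul a b : rnorm (cmul a b) <= rnorm a * rnorm b.
Proof. by rewrite -lecR rmorphM /= -!rnormE norm_cmul_le. Qed.

Lemma rnorm_cstar_cmul a : rnorm (cmul (cstar a) a) = rnorm a ^+ 2.
Proof. by apply: complexI; rewrite rmorphXn /= -!rnormE norm_cstar_cmul. Qed.

Lemma rnorm_cstar a : rnorm (cstar a) = rnorm a.
Proof.
suff le_star b : rnorm b <= rnorm (cstar b).
  by apply/le_anti; rewrite -{2}[a]cstarK !le_star.
have [b0|b0] := leP (rnorm b) 0; first exact: le_trans b0 (rnorm_ge0 _).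
by rewrite -(ler_pM2r b0) -expr2 -rnorm_cstar_cmul rnorm_cmul.
Qed.

Lemma rnorm_cmul_cstar a : rnorm (cmul a (cstar a)) = rnorm a ^+ 2.
Proof. by rewrite -{1}[a]cstarK rnorm_cstar_cmul rnorm_cstar. Qed.

End CstarBasics.

Definition unitization (R : realType) (A : cstarAlgType R) : Type :=
  (R[i] * A)%type.

Section Unitization.
Context {R : realType} {A : cstarAlgType R}.
Local Notation U := (unitization A).
Implicit Types (u v w : U) (a b x y : A) (c : R[i]).

HB.instance Definition _ := GRing.Zmodule.copy U (R[i] * A)%type.

Definition uscale c u : U := (c * u.1, c *: u.2).

Let uscaleA c d u : uscale c (uscale d u) = uscale (c * d) u.
Proof. by rewrite /uscale /= mulrA scalerA. Qed.

Let uscale1 : left_id 1 uscale.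
Proof. by move=> [r a]; rewrite /uscale /= mul1r scale1r. Qed.

Let uscaleDr : right_distributive uscale +%R.
Proof. by move=> c [r a] [s b]; rewrite /uscale /= mulrDr scalerDr. Qed.

Let uscaleDl u : {morph uscale^~ u : c d / c + d}.
Proof. by move=> c d; rewrite /uscale /= mulrDl scalerDl. Qed.

HB.instance Definition _ :=
  GRing.Zmodule_isLmodule.Build R[i] U uscaleA uscale1 uscaleDr uscaleDl.

Definition umul u v : U :=
  (u.1 * v.1, u.1 *: v.2 + v.1 *: u.2 + cmul u.2 v.2).

Let umulA : associative umul.
Proof.
move=> [r a] [s b] [t d]; rewrite /umul /= mulrA; congr pair.
rewrite !scalerDr !cmulDl !cmulDr !cmulZl !cmulZr !scalerA cmulA (mulrC t r) (mulrC t s).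
by rewrite !addrA [LHS](ACl (1*2*4*6*3*5*7)).
Qed.

Let umul1l : left_id (1, 0) umul.
Proof.
by move=> [r a]; rewrite /umul /= mul1r scale1r scaler0 cmul0l !addr0.
Qed.

Let umul1r : right_id (1, 0) umul.
Proof.
by move=> [r a]; rewrite /umul /= mulr1 scale1r scaler0 cmul0r addr0 add0r.
Qed.

Let umulDl : left_distributive umul +%R.
Proof.
move=> [r a] [s b] [t d]; rewrite /umul /= mulrDl; congr pair.
by rewrite scalerDl scalerDr cmulDl !addrA [LHS](ACl (1*3*5*2*4*6)).
Qed.

Let umulDr : right_distributive umul +%R.
Proof.
move=> [r a] [s b] [t d]; rewrite /umul /= mulrDr; congr pair.
by rewrite scalerDl scalerDr cmulDr !addrA [LHS](ACl (1*3*5*2*4*6)).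
Qed.

Let uone_neq0 : (1, 0) != 0 :> U.
Proof. by apply/eqP => -[/eqP]; rewrite oner_eq0. Qed.

HB.instance Definition _ :=
  GRing.Zmodule_isNzRing.Build U umulA umul1l umul1r umulDl umulDr uone_neq0.

Let uscaleAl c u v : uscale c (umul u v) = umul (uscale c u) v.
Proof.
by rewrite /umul /uscale /= mulrA cmulZl !scalerDr !scalerA [v.1 * c]mulrC.
Qed.

HB.instance Definition _ := GRing.Lmodule_isLalgebra.Build R[i] U uscaleAl.

Let uscaleAr c u v : uscale c (umul u v) = umul u (uscale c v).
Proof.
rewrite /umul /uscale /= cmulZr !scalerDr !scalerA [u.1 * c]mulrC.
by rewrite mulrA [c * u.1]mulrC mulrA.
Qed.

HB.instance Definition _ := GRing.Lalgebra_isAlgebra.Build R[i] U uscaleAr.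

Definition ustar u : U := ((u.1^*)%R, cstar u.2).
(** [A] is an ideal of its unitization; this is left multiplication on that ideal, whose operator
    norm is the source of the C*-norm [unorm]. *)
Definition uact u x : A := u.1 *: x + cmul u.2 x.
Definition uinj a : U := (0, a).

Lemma ustarK : involutive ustar.
Proof. by move=> [r a]; rewrite /ustar /= conjCK cstarK. Qed.

Lemma ustarD u v : ustar (u + v) = ustar u + ustar v.
Proof. by rewrite /ustar /= rmorphD cstarD. Qed.

Lemma ustarZ c u : ustar (c *: u) = (c^*)%R *: ustar u.
Proof. by rewrite /ustar /= rmorphM cstarZ. Qed.

Lemma ustarN u : ustar (- u) = - ustar u.
Proof. by rewrite /ustar /= rmorphN cstarN. Qed.

Lemma ustarB u v : ustar (u - v) = ustar u - ustar v.
Proof. by rewrite ustarD ustarN. Qed.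

Lemma ustarM u v : ustar (u * v) = ustar v * ustar u.
Proof.
rewrite /ustar /= !cstarD !cstarZ cstarM rmorphM mulrC.
by congr pair; rewrite /= [_ *: _ + _ *: _]addrC.
Qed.

Lemma ustar1 : ustar 1 = 1.
Proof. by rewrite /ustar /= rmorph1 cstar0. Qed.

Lemma ustar0 : ustar 0 = 0.
Proof. by rewrite /ustar /= rmorph0 cstar0. Qed.

Lemma uinjD a b : uinj (a + b) = uinj a + uinj b.
Proof. by rewrite /uinj -[X in (X, _)](addr0 0). Qed.

Lemma uinjN a : uinj (- a) = - uinj a.
Proof. by rewrite /uinj -[X in (X, _)]oppr0. Qed.

Lemma uinjZ c a : uinj (c *: a) = c *: uinj a.
Proof. by rewrite /uinj -[X in (X, _)](mulr0 c). Qed.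

Lemma uinjM a b : uinj (cmul a b) = uinj a * uinj b.
Proof.
rewrite -[RHS]/(umul (uinj a) (uinj b)) /umul /=.
by rewrite mulr0 !scale0r !add0r.
Qed.

Lemma ustar_inj a : ustar (uinj a) = uinj (cstar a).
Proof. by rewrite /ustar /= rmorph0. Qed.

Lemma uactM u v x : uact (u * v) x = uact u (uact v x).
Proof.
rewrite -[u * v]/(umul u v) /uact /=.
by rewrite scalerDr cmulDr !cmulDl !cmulZl !cmulZr cmulA !scalerA !addrA.
Qed.

Lemma uactD u v x : uact (u + v) x = uact u x + uact v x.
Proof. by rewrite /uact /= scalerDl cmulDl addrACA. Qed.

Lemma uactZ c u x : uact (c *: u) x = c *: uact u x.
Proof. by rewrite -[c *: u]/(uscale c u) /uact /= cmulZl scalerDr scalerA. Qed.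

Lemma uact_scaler c u x : uact u (c *: x) = c *: uact u x.
Proof. by rewrite /uact cmulZr scalerDr !scalerA mulrC. Qed.

Lemma uact0 u : uact u 0 = 0.
Proof. by rewrite -[X in uact u X](scale0r (0 : A)) uact_scaler scale0r. Qed.

Lemma uact_adj u x y :
  cmul (cstar (uact u x)) y = cmul (cstar x) (uact (ustar u) y).
Proof.
by rewrite /uact cstarD cstarZ cstarM cmulDl cmulDr cmulZl cmulZr cmulA.
Qed.

(* The maximum with [cabs u.1] keeps this definite when [A] already has a unit. *)
Definition unorm u : R :=
  Num.max (cabs u.1)
    (sup [set rnorm (uact u x) | x in [set x | rnorm x <= 1]]%classic).

Lemma rnorm_uact_le u x : rnorm (uact u x) <= (cabs u.1 + rnorm u.2) * rnorm x.
Proof.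
rewrite mulrDl -rnormZ; apply: le_trans (rnormD _ _) (lerD (lexx _) _).
exact: rnorm_cmul.
Qed.

Lemma cabs_le_unorm u : cabs u.1 <= unorm u.
Proof. by rewrite /unorm le_max lexx. Qed.

Lemma unorm_ge0 u : 0 <= unorm u.
Proof. exact: le_trans (cabs_ge0 _) (cabs_le_unorm u). Qed.

Lemma rnorm_uact u x : rnorm (uact u x) <= unorm u * rnorm x.
Proof.
have [x0|x0] := eqVneq (rnorm x) 0.
  by rewrite (rnorm_eq0 x0) uact0 rnorm0 mulr0.
have {}x0 : 0 < rnorm x by rewrite lt_def x0 rnorm_ge0.
rewrite -ler_pdivrMr // /unorm le_max; apply/orP; right.
have inv0 : 0 <= (rnorm x)^-1 by rewrite invr_ge0 ltW.
apply: ub_le_sup.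
  exists (cabs u.1 + rnorm u.2) => _ [y /= y1 <-].
  apply: le_trans (rnorm_uact_le _ _) _.
  by rewrite ler_piMr // addr_ge0 ?cabs_ge0 ?rnorm_ge0.
exists (((rnorm x)^-1)%:C%C *: x) => /=.
  by rewrite rnormZ [rnorm _]cabs_nneg // mulVf // gt_eqF.
by rewrite uact_scaler rnormZ [X in X * _]cabs_nneg // mulrC.
Qed.

Lemma unorm_le u t : 0 <= t -> cabs u.1 <= t ->
  (forall x, rnorm (uact u x) <= t * rnorm x) -> unorm u <= t.
Proof.
move=> t0 ut ux; rewrite /unorm ge_max ut /=; apply: ge_sup.
  by exists (rnorm (uact u 0)), 0 => //=; rewrite rnorm0.
move=> _ [x /= x1 <-]; apply: le_trans (ux x) _.
by rewrite ler_piMr.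
Qed.

Lemma unormD u v : unorm (u + v) <= unorm u + unorm v.
Proof.
apply: unorm_le => [||x]; first by rewrite addr_ge0 ?unorm_ge0.
  exact: le_trans (cabsD _ _) (lerD (cabs_le_unorm _) (cabs_le_unorm _)).
rewrite uactD mulrDl.
exact: le_trans (rnormD _ _) (lerD (rnorm_uact _ _) (rnorm_uact _ _)).
Qed.

Lemma unormM u v : unorm (u * v) <= unorm u * unorm v.
Proof.
apply: unorm_le => [||x]; first by rewrite mulr_ge0 ?unorm_ge0.
  by rewrite cabsM ler_pM ?cabs_ge0 ?cabs_le_unorm.
rewrite uactM -mulrA; apply: le_trans (rnorm_uact _ _) _.
by rewrite ler_wpM2l ?unorm_ge0 ?rnorm_uact.
Qed.

Lemma unormZ_le c u : unorm (c *: u) <= cabs c * unorm u.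
Proof.
apply: unorm_le => [||x]; first by rewrite mulr_ge0 ?unorm_ge0 ?cabs_ge0.
  by rewrite cabsM ler_wpM2l ?cabs_ge0 ?cabs_le_unorm.
by rewrite uactZ rnormZ -mulrA ler_wpM2l ?cabs_ge0 ?rnorm_uact.
Qed.

Lemma unormN u : unorm (- u) = unorm u.
Proof.
suff le v : unorm (- v) <= unorm v by apply/le_anti; rewrite le -{1}[u]opprK le.
rewrite -scaleN1r; apply: le_trans (unormZ_le _ _) _.
by rewrite [cabs _](@rnormN _ (R[i]^o)) -/(cabs 1) cabs1 mul1r.
Qed.

Lemma unormB u v : unorm (u - v) <= unorm u + unorm v.
Proof. by rewrite -[unorm v]unormN unormD. Qed.

Lemma unorm0 : unorm 0 = 0.
Proof.
apply/le_anti; rewrite unorm_ge0 andbT -(scale0r (0 : U)).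
by apply: le_trans (unormZ_le _ _) _; rewrite cabs0 mul0r.
Qed.

Lemma unorm1_le : unorm 1 <= 1.
Proof.
apply: unorm_le => [||x]; rewrite ?ler01 ?cabs1 //.
by rewrite /uact /= scale1r cmul0l addr0 mul1r.
Qed.

(** The estimate [|v x|^2 = |x^* (v^* v x)| <= |v^* v| |x|^2] bounds [|v|^2] by [|v^* v|]. It also
    yields [|v| <= |v^*|], hence the reverse inequality. *)
Lemma unorm_star_mul u : unorm (ustar u * u) = unorm u ^+ 2.
Proof.
have le_mul v : unorm v ^+ 2 <= unorm (ustar v * v).
  rewrite -[leRHS]sqr_sqrtr ?unorm_ge0 // ler_pXn2r ?nnegrE ?sqrtr_ge0 ?unorm_ge0 //.
  apply: unorm_le => [||x]; rewrite ?sqrtr_ge0 //.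
    rewrite -[leLHS]ger0_norm ?cabs_ge0 // -sqrtr_sqr ler_sqrt ?unorm_ge0 //.
    by apply: le_trans (cabs_le_unorm _); rewrite cabsM cabs_conj expr2.
  rewrite -[leLHS]ger0_norm ?rnorm_ge0 // -sqrtr_sqr -[rnorm x]ger0_norm ?rnorm_ge0 //.
  rewrite -sqrtr_sqr -sqrtrM ?unorm_ge0 // ler_sqrt; last first.
    by rewrite mulr_ge0 ?unorm_ge0 ?sqr_ge0.
  rewrite -rnorm_cstar_cmul uact_adj -uactM; apply: le_trans (rnorm_cmul _ _) _.
  by rewrite rnorm_cstar expr2 mulrCA ler_wpM2l ?rnorm_ge0 ?rnorm_uact.
have le_star v : unorm v <= unorm (ustar v).
  have [v0|v0] := leP (unorm v) 0; first exact: le_trans v0 (unorm_ge0 _).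
  rewrite -(ler_pM2r v0) -expr2; apply: le_trans (le_mul _) (unormM _ _).
apply/le_anti; rewrite le_mul andbT; apply: le_trans (unormM _ _) _.
by rewrite expr2 ler_wpM2r ?unorm_ge0 // -{2}[u]ustarK le_star.
Qed.

Lemma unorm_star u : unorm (ustar u) = unorm u.
Proof.
suff le_star v : unorm v <= unorm (ustar v).
  by apply/le_anti; rewrite -{2}[u]ustarK !le_star.
have [v0|v0] := leP (unorm v) 0; first exact: le_trans v0 (unorm_ge0 _).
by rewrite -(ler_pM2r v0) -expr2 -unorm_star_mul unormM.
Qed.

(** Let [u] act on the adjoint of [u.2] and subtract the scalar part: an element of norm [|u.2|^2]
    remains. Definiteness and completeness of [unorm] rest on this. *)
Lemma rnorm_snd_le u : rnorm u.2 <= 2 * unorm u.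
Proof.
have [u0|u0] := leP (rnorm u.2) 0.
  by apply: le_trans u0 _; rewrite mulr_ge0 ?unorm_ge0.
rewrite -(ler_pM2r u0) -expr2 -rnorm_cmul_cstar.
have -> : cmul u.2 (cstar u.2) = uact u (cstar u.2) - u.1 *: cstar u.2.
  by rewrite /uact addrAC subrr add0r.
apply: le_trans (rnormB _ _) _; rewrite rnormZ.
have := rnorm_uact u (cstar u.2); rewrite rnorm_cstar => le1.
have := ler_wpM2r (ltW u0) (cabs_le_unorm u) => le2.
by rewrite mulrDl mul1r mulrDl lerD.
Qed.

Lemma unorm_eq0 u : unorm u = 0 -> u = 0.
Proof.
move=> u0; have := rnorm_snd_le u; have := cabs_le_unorm u; rewrite u0 mulr0 => u1 u2.
case: u u1 u2 {u0} => r a /= r0 a0; congr pair.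
  by apply: (@rnorm_eq0 _ (R[i]^o)); apply/le_anti; rewrite r0 rnorm_ge0.
by apply: rnorm_eq0; apply/le_anti; rewrite a0 rnorm_ge0.
Qed.

Lemma unorm_inj a : unorm (uinj a) = rnorm a.
Proof.
apply/le_anti/andP; split.
  apply: unorm_le => [||x]; rewrite ?rnorm_ge0 ?cabs0 ?rnorm_ge0 //.
  by rewrite /uact /= scale0r add0r rnorm_cmul.
have [a0|a0] := leP (rnorm a) 0; first exact: le_trans a0 (unorm_ge0 _).
rewrite -(ler_pM2r a0) -expr2 -rnorm_cmul_cstar.
have -> : cmul a (cstar a) = uact (uinj a) (cstar a).
  by rewrite /uact /= scale0r add0r.
by rewrite -[in leRHS](rnorm_cstar a) rnorm_uact.
Qed.

Lemma unorm_complete (z : nat -> U) (e : nat -> R) : vanishing e ->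
    (forall n m, (n <= m)%N -> unorm (z m - z n) <= e n) ->
  exists l, forall n, unorm (l - z n) <= 4 * e n.
Proof.
move=> e0 ze.
have [|r hr] := @cabs_cauchy _ (fun n => (z n).1) _ e0.
  by move=> n m nm; apply: le_trans (cabs_le_unorm (z m - z n)) (ze _ _ nm).
have [||a ha] := @rnorm_cauchy _ A (fun n => (z n).2) (fun n => 2 * e n).
- move=> eps eps0; have [|n hn] := e0 (eps / 2); first by rewrite divr_gt0.
  by exists n; lra.
- move=> n m nm; apply: le_trans (rnorm_snd_le (z m - z n)) _.
  by have := ze _ _ nm; lra.
exists (r, a) => n.
have -> : (r, a) - z n = (r - (z n).1)%:A + uinj (a - (z n).2) :> U.
  rewrite -[_%:A]/(uscale _ 1) /uscale /uinj /= mulr1 scaler0.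
  by case: (z n) => s b; congr pair; rewrite /= ?addr0 ?add0r.
apply: le_trans (unormD _ _) _; rewrite unorm_inj.
have := unormZ_le (r - (z n).1) 1; have := unorm1_le; have := cabs_ge0 (r - (z n).1).
move: (hr n) (ha n) => h1 h2 h3 h4 h5; have := ler_wpM2l h3 h4; lra.
Qed.

End Unitization.

(** * Positivity in C*-algebras *)

Section CstarPositivity.
Context {R : realType} {A : cstarAlgType R}.
Local Notation U := (unitization A).
Local Notation "t %:U" := (t%:C%C%:A : U) (at level 1, left associativity, format "t %:U").
Implicit Types (u v w h k b d y z : U) (t c : R).

Lemma conjC_real t : ((t%:C%C)^*)%R = t%:C%C :> R[i].
Proof. by apply/CrealP; rewrite complex_real. Qed.

Lemma unormZ t u : 0 <= t -> unorm (t%:C%C *: u) = t * unorm u.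
Proof.
move=> t0; have le_scale c v : 0 <= c -> unorm (c%:C%C *: v) <= c * unorm v.
  by move=> c0; apply: le_trans (unormZ_le _ _) _; rewrite cabs_nneg.
apply/le_anti; rewrite le_scale //=.
rewrite le_eqVlt in t0; case/orP: t0 => [/eqP <-|t0].
  by rewrite mul0r unorm_ge0.
have t0' : 0 <= t^-1 by rewrite invr_ge0 ltW.
have := le_scale _ (t%:C%C *: u) t0'.
rewrite scalerA -rmorphM /= mulVf ?gt_eqF // rmorph1 scale1r.
by rewrite -ler_pdivlMl ?invr_gt0 // invrK.
Qed.

Lemma ustarZr t u : ustar (t%:C%C *: u) = t%:C%C *: ustar u.
Proof. by rewrite ustarZ conjC_real. Qed.

Lemma ustar_real t : ustar t%:U = t%:U.
Proof. by rewrite ustarZr ustar1. Qed.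

Lemma unorm_sq u : ustar u = u -> unorm (u * u) = unorm u ^+ 2.
Proof. by move=> {1}<-; rewrite unorm_star_mul. Qed.

Lemma sq_eq0 u : ustar u = u -> u * u = 0 -> u = 0.
Proof.
move=> su uu; apply: unorm_eq0; apply/eqP; rewrite -sqrf_eq0.
by rewrite -unorm_sq // uu unorm0.
Qed.

Lemma halfD u : (2^-1)%:C%C *: u + (2^-1)%:C%C *: u = u.
Proof.
rewrite -scalerDl -rmorphD /= (_ : 2^-1 + 2^-1 = 1) ?rmorph1 ?scale1r //.
by field.
Qed.

Section Iteration.
Variable k : U.
Hypotheses (sk : ustar k = k) (k1 : unorm k <= 1).

(** A fixed point satisfies [2 z = k + z^2], that is [(1 - z)^2 = 1 - k]. The scalar sequence [s],
    the same iteration with 1 in place of [k], increases to 1 and majorizes both the norms and the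
    increments of [z]. *)
Let z := fix z n : U := if n is n'.+1 then (2^-1)%:C%C *: (k + z n' * z n') else 0.
Let s := fix s n : R := if n is n'.+1 then (1 + s n' ^+ 2) / 2 else 0.

Let s_bnd n : 0 <= s n <= 1.
Proof. elim: n => [|n IH] /=; rewrite ?lexx ?ler01 //; nra. Qed.

Let s_incr n : s n <= s n.+1.
Proof. have := s_bnd n; rewrite /=; have := sqr_ge0 (1 - s n); nra. Qed.

Let e n := 1 - s n.

(** The recursion is [d - d^2 / 2] for [d = e n]: the limit 1 of [s] is a double root, so the decay
    is only of order [1 / n]. The induction step is [(2 - d N) (1 - d / 2) >= 0] with
    [N = n + 2]. *)
Let e_rate n : e n * n.+2%:R <= 2.
Proof.
rewrite /e; elim: n => [|n IH]; first by rewrite /= subr0 mul1r.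
have := s_bnd n; move: IH; rewrite /= -[n.+3%:R]natr1.
have : 2 <= n.+2%:R :> R by rewrite ler_nat.
move: (n.+2%:R : R) (s n) => N x N2; set d := 1 - x => dN /andP[x0 x1].
have -> : 1 - (1 + x ^+ 2) / 2 = d - d ^+ 2 / 2 by rewrite /d; field.
have d0 : 0 <= d by rewrite subr_ge0.
have d2 : 0 <= 1 - d / 2 by rewrite /d; lra.
by have := mulr_ge0 (_ : 0 <= 2 - d * N) d2; rewrite subr_ge0 => /(_ dN); nra.
Qed.

Let e_vanishing : vanishing e.
Proof.
move=> eps eps0; exists (Num.bound (2 / eps)).
set n := Num.bound _; have : 2 / eps < n%:R.
  by apply: Num.Theory.archi_boundP; rewrite divr_ge0 // ltW.
rewrite ltr_pdivrMr // => hn; have := e_rate n.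
have : n%:R < n.+2%:R :> R by rewrite ltr_nat.
have : 0 <= n%:R :> R by [].
move: (n%:R : R) (n.+2%:R : R) hn => p q hn p0 pq eq.
have {hn}hn : 2 < eps * q by nra.
by rewrite ltNge; apply/negP => le; have := ler_wpM2r (le_trans p0 (ltW pq)) le; lra.
Qed.

Let z_star n : ustar (z n) = z n.
Proof.
by elim: n => [|n IH] /=; rewrite ?ustar0 // ustarZr ustarD sk ustarM IH.
Qed.

Let z_comm n w : k * w = w * k -> z n * w = w * z n.
Proof.
move=> kw; elim: n => [|n IH] /=; first by rewrite mul0r mulr0.
by rewrite -scalerAl -scalerAr mulrDl mulrDr kw -mulrA IH mulrA IH mulrA.
Qed.

Let z_norm n : unorm (z n) <= s n.
Proof.
elim: n => [|n IH] /=; first by rewrite unorm0.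
rewrite unormZ ?invr_ge0 //; have := unormD k (z n * z n).
have : unorm (z n * z n) <= s n ^+ 2.
  by apply: le_trans (unormM _ _) _; rewrite expr2 ler_pM ?unorm_ge0.
by move: k1; lra.
Qed.

(** All iterates commute, so the increments of [z] and of [s] obey the same factorization
    [(x - y) (x + y) / 2] and compare factor by factor. *)
Let z_step n : unorm (z n.+1 - z n) <= s n.+1 - s n.
Proof.
elim: n => [|n IH].
  by rewrite /= !subr0 mulr0 addr0 unormZ ?invr_ge0 // expr0n /= addr0; move: k1; lra.
have -> : z n.+2 - z n.+1 = (2^-1)%:C%C *: ((z n.+1 - z n) * (z n.+1 + z n)).
  rewrite [z n.+2]/= [z n.+1 in LHS]/= -scalerBr; congr *:%R.
  rewrite opprD addrACA subrr add0r -/(z n.+1).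
  have c : z n.+1 * z n = z n * z n.+1 by apply: z_comm; rewrite z_comm.
  by rewrite mulrDr !mulrBl c subrKA.
rewrite unormZ ?invr_ge0 //.
have -> : s n.+2 - s n.+1 = 2^-1 * ((s n.+1 - s n) * (s n.+1 + s n)).
  have sE m : s m.+1 = (1 + s m ^+ 2) / 2 by [].
  by rewrite [s n.+2]sE [X in _ - X]sE; move: (s n.+1) (s n) => x y; field.
rewrite ler_wpM2l ?invr_ge0 //; apply: le_trans (unormM _ _) _.
apply: ler_pM; rewrite ?unorm_ge0 //.
by apply: le_trans (unormD _ _) (lerD _ _); exact: z_norm.
Qed.

Let z_cauchy n m : (n <= m)%N -> unorm (z m - z n) <= e n.
Proof.
suff : (n <= m)%N -> unorm (z m - z n) <= s m - s n.
  by move=> h /h; rewrite /e; move: (s_bnd m); lra.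
move/subnKC <-; elim: (m - n)%N => [|p IH]; first by rewrite addn0 !subrr unorm0.
rewrite addnS; have := unormD (z (n + p).+1 - z (n + p)%N) (z (n + p)%N - z n).
rewrite subrKA; have := z_step (n + p); lra.
Qed.

(** The last clause, inherited from the polynomials [z n] in [k], stands for the fact that [y] lies
    in the closed algebra generated by [k]; the later commutations of square roots rest on it. *)
Lemma half_root : exists y, [/\ ustar y = y, unorm y <= 1, y + y = k + y * y &
  forall w, k * w = w * k -> y * w = w * y].
Proof.
have [l zl] := unorm_complete e_vanishing z_cauchy.
have null u c : 0 <= c -> (forall n, unorm u <= c * e n) -> u = 0.
  move=> c0 /(vanishing_le0 e_vanishing c0) u0.
  by apply: unorm_eq0; apply/le_anti; rewrite u0 unorm_ge0.
have e_ge0 n : 0 <= e n by rewrite /e; move: (s_bnd n); lra.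
have l1 : unorm l <= 1.
  rewrite -subr_le0; apply: (vanishing_le0 (c := 4) e_vanishing) => // n.
  have := unormD (l - z n) (z n); rewrite subrK.
  have := zl n; have := z_norm n; have := s_bnd n; lra.
exists l; split=> //.
- apply/eqP; rewrite -subr_eq0; apply/eqP; apply: (null _ 8) => // n.
  have -> : ustar l - l = ustar (l - z n) - (l - z n).
    by rewrite ustarB z_star opprB addrA subrK.
  by have := unormB (ustar (l - z n)) (l - z n); rewrite unorm_star; have := zl n; lra.
- apply/eqP; rewrite -subr_eq0; apply/eqP; apply: (null _ 16) => // n.
  have -> : l + l - (k + l * l) =
      (l - z n.+1) + (l - z n.+1) - ((l - z n) * z n + l * (l - z n)).
    have zz : z n.+1 + z n.+1 = k + z n * z n.
      exact: halfD.
    rewrite mulrBl mulrBr addrACA -opprD zz -[RHS]addrA -opprD; congr (_ - _).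
    by rewrite [l * z n - _ + _]addrC subrKA addrACA subrr addr0.
  have := unormB ((l - z n.+1) + (l - z n.+1)) ((l - z n) * z n + l * (l - z n)).
  have := unormD (l - z n.+1) (l - z n.+1); have := unormD ((l - z n) * z n) (l * (l - z n)).
  have := unormM (l - z n) (z n); have := unormM l (l - z n).
  have : e n.+1 <= e n by rewrite /e lerD2l lerN2 s_incr.
  have := zl n; have := zl n.+1; have := z_norm n; have := s_bnd n.
  have := unorm_ge0 (l - z n); have := unorm_ge0 (z n); have := unorm_ge0 l.
  nra.
- move=> w kw; apply/eqP; rewrite -subr_eq0; apply/eqP.
  apply: (null _ (8 * unorm w)) => [|n]; first by rewrite mulr_ge0 ?unorm_ge0.
  have -> : l * w - w * l = (l - z n) * w - w * (l - z n).
    by rewrite mulrBl mulrBr z_comm // opprB addrA subrK.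
  have := unormB ((l - z n) * w) (w * (l - z n)).
  have := unormM (l - z n) w; have := unormM w (l - z n).
  have := zl n; have := unorm_ge0 w; have := e_ge0 n; nra.
Qed.

End Iteration.

(* [u] is the real part of the normal element [u + i v]. *)
Lemma unorm_sq_addl u v : ustar u = u -> ustar v = v -> u * v = v * u ->
  unorm u ^+ 2 <= unorm (u * u + v * v).
Proof.
move=> su sv uv; pose z := u + 'i *: v.
have sz : ustar z = u - 'i *: v by rewrite ustarD ustarZ su sv conjCi scaleNr.
have -> : u * u + v * v = ustar z * z.
  rewrite sz mulrDr !mulrBl -!scalerAl -!scalerAr scalerA -(expr2 'i) sqrCi.
  by rewrite scaleN1r opprK uv addrA subrK.
rewrite unorm_star_mul ler_pXn2r ?nnegrE ?unorm_ge0 //.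
have -> : u = (2^-1)%:C%C *: (z + ustar z).
  by rewrite sz addrACA subrr addr0 scalerDr halfD.
rewrite unormZ ?invr_ge0 //.
by have := unormD z (ustar z); rewrite unorm_star; lra.
Qed.

Definition upos h := ustar h = h /\ exists2 t, 0 <= t & unorm (t%:U - h) <= t.

Lemma uposD h k : upos h -> upos k -> upos (h + k).
Proof.
move=> [sh [t t0 ht]] [sk [c c0 kc]]; split; first by rewrite ustarD sh sk.
exists (t + c); first exact: addr_ge0.
rewrite rmorphD /= scalerDl opprD addrACA.
exact: le_trans (unormD _ _) (lerD ht kc).
Qed.

Lemma uposZ c h : 0 <= c -> upos h -> upos (c%:C%C *: h).
Proof.
move=> c0 [sh [t t0 ht]]; split; first by rewrite ustarZr sh.
exists (c * t); first exact: mulr_ge0.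
by rewrite rmorphM /= -scalerA -scalerBr unormZ // ler_wpM2l.
Qed.

Lemma one_sub_sq z k : z + z = k + z * z -> (1 - z) * (1 - z) = 1 - k.
Proof.
by move=> zz; rewrite mulrBl mul1r mulrBr mulr1 -addrA -opprD addrA zz addrK.
Qed.

(** For [t > 0], positivity says that [k = 1 - h / t] has norm at most 1, and [half_root] gives
    [(1 - z)^2 = h / t]. The root is again [upos] because [|z| <= 1]. *)
Lemma upos_sqrt h : upos h ->
  exists y, [/\ upos y, y * y = h & forall w, h * w = w * h -> y * w = w * y].
Proof.
move=> [sh [t]]; rewrite le_eqVlt => /orP[/eqP <-|t0] ht.
  have h0 : h = 0.
    apply: unorm_eq0; apply/le_anti; rewrite unorm_ge0 andbT.
    by move: ht; rewrite rmorph0 scale0r sub0r unormN.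
  exists 0; split=> [||w _]; rewrite ?mul0r ?mulr0 //.
  by split; [exact: ustar0 | exists 0; rewrite // rmorph0 scale0r subrr unorm0].
have tV : (t^-1)%:C%C * t%:C%C = 1 :> R[i] by rewrite -rmorphM /= mulVf ?gt_eqF.
have tV0 : 0 <= t^-1 by rewrite invr_ge0 ltW.
pose k := 1 - (t^-1)%:C%C *: h.
have [||z [sz z1 zz cz]] := @half_root k.
- by rewrite ustarB ustar1 ustarZr sh.
- have -> : k = (t^-1)%:C%C *: (t%:U - h) by rewrite scalerBr scalerA tV scale1r.
  by rewrite unormZ // mulrC ler_pdivrMr // mul1r.
exists ((Num.sqrt t)%:C%C *: (1 - z)); split.
- split; first by rewrite ustarZr ustarB ustar1 sz.
  exists (Num.sqrt t); rewrite ?sqrtr_ge0 // -scalerBr opprB addrC subrK.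
  by rewrite unormZ ?sqrtr_ge0 // ler_piMr ?sqrtr_ge0.
- rewrite -scalerAl -scalerAr scalerA -rmorphM /= -expr2 sqr_sqrtr ?ltW //.
  by rewrite (one_sub_sq zz) subKr scalerA mulrC tV scale1r.
- move=> w hw; rewrite -scalerAl -scalerAr mulrBl mulrBr mul1r mulr1 cz //.
  by rewrite /k mulrBl mulrBr mul1r mulr1 -scalerAl -scalerAr hw.
Qed.

Lemma sqrt_one_sub_sq u : ustar u = u -> unorm u <= 1 ->
  exists y, [/\ ustar y = y, u * u + y * y = 1 &
    forall w, u * w = w * u -> y * w = w * y].
Proof.
move=> su u1; have [||z [sz z1 zz cz]] := @half_root (u * u).
- by rewrite ustarM su.
- by rewrite unorm_sq // expr_le1 // unorm_ge0.
exists (1 - z); split; first by rewrite ustarB ustar1 sz.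
- by rewrite (one_sub_sq zz) addrC subrK.
- move=> w uw; rewrite mulrBl mulrBr mul1r mulr1 cz //.
  by rewrite -mulrA uw mulrA uw mulrA.
Qed.

(** After scaling, [1 - v^2 = y^2] with [y] commuting with [v], and [unorm_sq_addl] bounds [|y|^2]
    by [|v^2 + y^2| = 1]. The 1 in [c] avoids a division by 0. *)
Lemma upos_sq u : ustar u = u -> upos (u * u).
Proof.
move=> su; pose c := unorm u + 1; pose v := (c^-1)%:C%C *: u.
have c0 : 0 < c by apply: ltr_wpDl; rewrite ?unorm_ge0.
have uE : u = c%:C%C *: v.
  by rewrite scalerA -rmorphM /= divff ?gt_eqF // rmorph1 scale1r.
have sv : ustar v = v by rewrite ustarZr su.
have v1 : unorm v <= 1.
  by rewrite unormZ ?invr_ge0 ?(ltW c0) // mulrC ler_pdivrMr // mul1r lerDl.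
have [y [sy vy cy]] := sqrt_one_sub_sq sv v1.
have -> : u * u = (c * c)%:C%C *: (v * v).
  by rewrite uE -scalerAl -scalerAr scalerA rmorphM.
apply: uposZ; first by rewrite mulr_ge0 // ltW.
split; first by rewrite ustarM sv.
exists 1 => //; rewrite rmorph1 scale1r -vy addrAC subrr add0r unorm_sq //.
apply: le_trans (unorm_sq_addl sy sv _) _; first by rewrite cy.
by rewrite addrC vy unorm1_le.
Qed.

Lemma unorm1 : unorm (1 : U) = 1.
Proof.
by apply/le_anti; rewrite unorm1_le -[leLHS]cabs1; exact: (cabs_le_unorm (1 : U)).
Qed.

(* With [w = v / |v|] and [1 - w^2 = y^2], the product
   [w^2 (t + w^2) = (t + 1) w^4 + t (w y)^2] is a sum of commuting squares. *)
Lemma unorm_real_add_sq t v : 0 <= t -> ustar v = v ->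
  t + unorm v ^+ 2 <= unorm (t%:U + v * v).
Proof.
move=> t0 sv; have := unorm_ge0 v; rewrite le_eqVlt => /orP[/eqP v0|].
  have -> : v = 0 by apply: unorm_eq0.
  by rewrite mul0r unorm0 expr0n !addr0 unormZ // unorm1 mulr1.
set r := unorm v => r0; pose w : U := (r^-1)%:C%C *: v.
have vE : v = r%:C%C *: w.
  by rewrite scalerA -rmorphM /= divff ?gt_eqF // rmorph1 scale1r.
have sw : ustar w = w by rewrite ustarZr sv.
have w1 : unorm w = 1 by rewrite unormZ ?invr_ge0 ?(ltW r0) // mulVf ?gt_eqF.
clearbody w; have [|y [sy wy cy]] := sqrt_one_sub_sq sw; first by rewrite w1.
have {}cy : y * w = w * y by rewrite cy.
pose q := t / r ^+ 2; have q0 : 0 <= q by rewrite divr_ge0 // exprn_ge0 // ltW.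
have -> : t%:U + v * v = (r ^+ 2)%:C%C *: (q%:U + w * w).
  rewrite scalerDr scalerA -rmorphM /= mulrC divfK ?expf_neq0 ?gt_eqF //.
  by rewrite vE -scalerAl -scalerAr scalerA rmorphXn.
have -> : t + r ^+ 2 = r ^+ 2 * (q + 1).
  by rewrite mulrDr mulr1 mulrC divfK ?expf_neq0 ?gt_eqF.
rewrite unormZ ?exprn_ge0 ?(ltW r0) // ler_wpM2l ?exprn_ge0 ?(ltW r0) //.
pose a : U := (Num.sqrt (q + 1))%:C%C *: (w * w); pose d : U := (Num.sqrt q)%:C%C *: (w * y).
have q10 : 0 <= q + 1 by rewrite addr_ge0.
have -> : q + 1 = unorm a ^+ 2.
  by rewrite unormZ ?sqrtr_ge0 // exprMn sqr_sqrtr // unorm_sq // w1 !expr1n mulr1.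
have sa : ustar a = a by rewrite ustarZr ustarM sw.
have sd : ustar d = d by rewrite ustarZr ustarM sw sy cy.
have ad : a * d = d * a.
  rewrite -!scalerAl -!scalerAr scalerA [RHS]scalerA mulrC; congr *:%R.
  have yww : y * (w * w) = w * w * y by rewrite mulrA cy -mulrA cy mulrA.
  by rewrite -[RHS]mulrA yww !mulrA.
apply: le_trans (unorm_sq_addl sa sd ad) _.
have -> : a * a + d * d = w * w * (q%:U + w * w).
  rewrite -!scalerAl -!scalerAr !scalerA -!rmorphM /= -!(expr2 (Num.sqrt _)) !sqr_sqrtr //.
  have -> : w * y * (w * y) = w * w * (y * y).
    by rewrite -!mulrA; congr *%R; rewrite !mulrA cy.
  rewrite [RHS]mulrDr -scalerAr mulr1 -[in X in q%:C%C *: X + _](mulr1 (w * w)) -wy.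
  by rewrite mulrDr scalerDr rmorphD rmorph1 scalerDl scale1r addrAC.
by apply: le_trans (unormM _ _) _; rewrite unorm_sq // w1 expr1n mul1r.
Qed.

Lemma ustarX u n : ustar (u ^+ n) = ustar u ^+ n.
Proof. by elim: n => [|n IH]; rewrite ?ustar1 // exprS ustarM IH exprSr. Qed.

Lemma unorm_exp2 u n : ustar u = u -> unorm (u ^+ (2 ^ n)) = unorm u ^+ (2 ^ n).
Proof.
move=> su; elim: n => [|n IH]; first by rewrite !expr1.
rewrite expnS mulnC !exprM -IH expr2 unorm_sq //.
by rewrite ustarX su.
Qed.

(** A substitute for the spectral radius formula: the powers of [r / c > 1] outgrow any affine
    function of the exponent. Exponents [2^n] are the ones for which [|u^m| = |u|^m] is available
    for self-adjoint [u]. *)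
Lemma exp2_growth (r c d : R) : 0 < c -> 0 <= d ->
  (forall n, c * r ^+ (2 ^ n) <= c ^+ (2 ^ n) * (c + (2 ^ n)%:R * d)) -> r <= c.
Proof.
move=> c0 d0 hr; rewrite leNgt; apply/negP => cr.
pose x := r / c - 1; have x0 : 0 < x by rewrite subr_gt0 ltr_pdivlMr ?mul1r.
have rE : r = c * (1 + x) by rewrite /x addrC subrK mulrC divfK ?gt_eqF.
(* Bernoulli's inequality at [m = 2^k], squared, gives [(m x)^2] at exponent [2^(k+1)]; this [k]
   makes [m c x^2] exceed [c + 2 d], so that [c (m x)^2] beats [c + 2 m d]. *)
pose k := Num.bound ((c + 2 * d) / (c * x ^+ 2)); pose m : R := (2 ^ k)%:R.
have cx0 : 0 < c * x ^+ 2 by rewrite mulr_gt0 ?exprn_gt0.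
have km : (c + 2 * d) / (c * x ^+ 2) < m.
  apply: lt_le_trans (_ : k%:R <= _).
    by apply: Num.Theory.archi_boundP; rewrite divr_ge0 ?(ltW cx0) ?addr_ge0 ?mulr_ge0 ?(ltW c0).
  by rewrite ler_nat ltnW // ltn_expl.
have := hr k.+1; rewrite rE exprMn mulrCA ler_pM2l ?exprn_gt0 //.
rewrite expnS mulnC exprM natrM -/m.
have : 1 + m * x <= (1 + x) ^+ (2 ^ k).
  rewrite /m mulr_natl; elim: (2 ^ k)%N => [|n IH]; first by rewrite mulr0n addr0.
  rewrite exprS mulrS; have : 0 <= x *+ n by rewrite mulrn_wge0 // ltW.
  nra.
have m1 : 1 <= m by rewrite ler1n expn_gt0.
move: km; rewrite ltr_pdivrMr //; move: ((1 + x) ^+ (2 ^ k)) m1 => y m1 km my le.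
clearbody m k x; have m0 : 0 < m by apply: lt_le_trans m1.
have mx0 : 0 <= m * x by rewrite mulr_ge0 // ltW.
have my2 : (m * x) ^+ 2 <= y ^+ 2 by rewrite ler_pXn2r ?nnegrE //; lra.
have := ler_wpM2l (ltW c0) my2; have := ler_peMl (ltW c0) m1.
rewrite -(ltr_pM2l m0) in km; lra.
Qed.

(* The products [d^* d] and [d d^*] have the same nonzero spectrum; in terms of
   norms, the powers of [c + d d^*] grow at most linearly faster than [c^n]. *)
Lemma upos_neg_swap d : upos (- (ustar d * d)) -> upos (- (d * ustar d)).
Proof.
move=> [_ [t t0 ht]]; split; first by rewrite ustarN ustarM ustarK.
(* With this shift [X = 1 + (t + d^* d)] has norm at most [1 + t = c]; the 1 keeps [c] positive. *)
pose c := t + 1; have c0 : 0 < c by apply: ltr_wpDl.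
pose X := c%:U + ustar d * d; pose M := c%:U + d * ustar d.
have Xc : unorm X <= c.
  have -> : X = 1 + (t%:U - - (ustar d * d)).
    by rewrite /X /c rmorphD rmorph1 /= scalerDl scale1r opprK [t%:U + 1]addrC addrA.
  by apply: le_trans (unormD _ _) _; rewrite unorm1 [leLHS]addrC /c lerD2r.
exists c; first exact: ltW.
rewrite opprK -/M; apply: (@exp2_growth _ _ (unorm d ^+ 2)) => //; first exact: exprn_ge0 (unorm_ge0 _).
move=> k; have sM : ustar M = M by rewrite ustarD ustar_real ustarM ustarK.
rewrite -unorm_exp2 //; elim: (2 ^ k)%N => {k} [|n IH].
  by rewrite !expr0 unorm1 mulr1 mul0r addr0 mul1r.
(* This gives [M^(n+1) = c M^n + d X^n d^*]: each power adds one term of size [|d|^2 c^n], whence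
   the linear growth. *)
have Md m : M ^+ m * d = d * X ^+ m.
  elim: m => [|m IHm]; first by rewrite mul1r mulr1.
  rewrite exprSr -mulrA.
  have -> : M * d = d * X by rewrite mulrDl mulrDr -scalerAl -scalerAr mul1r mulr1 mulrA.
  by rewrite mulrA IHm -mulrA -exprSr.
have -> : M ^+ n.+1 = c%:C%C *: M ^+ n + d * X ^+ n * ustar d.
  by rewrite exprSr {2}/M mulrDr -scalerAr mulr1 mulrA Md.
have Xn : unorm (X ^+ n) <= c ^+ n.
  elim: n {IH} => [|n IH]; first by rewrite !expr0 unorm1.
  by rewrite !exprS; apply: le_trans (unormM _ _) _; rewrite ler_pM ?unorm_ge0.
have dX : unorm (d * X ^+ n * ustar d) <= unorm d ^+ 2 * c ^+ n.
  apply: le_trans (unormM _ _) _; rewrite unorm_star expr2 mulrAC -mulrA.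
  apply: le_trans (ler_wpM2r (unorm_ge0 _) (unormM _ _)) _.
  by rewrite -mulrA ler_wpM2l ?unorm_ge0 // ler_wpM2r ?unorm_ge0.
apply: le_trans (_ : c * (c * unorm (M ^+ n) + unorm (d * X ^+ n * ustar d)) <= _).
  by rewrite ler_wpM2l ?(ltW c0) // -unormZ ?(ltW c0) // unormD.
rewrite (exprS c n) -[leRHS]mulrA ler_wpM2l ?(ltW c0) //.
have -> : c ^+ n * (c + n.+1%:R * unorm d ^+ 2) =
    c ^+ n * (c + n%:R * unorm d ^+ 2) + unorm d ^+ 2 * c ^+ n.
  by rewrite -[n.+1%:R]natr1 mulrDl mul1r addrA mulrDr [_ ^+ 2 * c ^+ n]mulrC.
exact: lerD.
Qed.

(* Fukamiya's argument: [w = |c| - c] is twice the negative part of [c], and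
   [d = b w] has [d^* d <= 0], which forces [w = 0]. *)
Lemma upos_star_mul b : upos (ustar b * b).
Proof.
set c := ustar b * b; have sc : ustar c = c by rewrite ustarM ustarK.
(* [a] is [|c|] and [e] its square root; positivity of [c] will come out as [c = a]. *)
have [a [pa aa ca]] := upos_sqrt (upos_sq sc).
have [e [pe ee ce]] := upos_sqrt pa.
have ac : a * c = c * a by apply: ca; rewrite mulrA.
have ec : e * c = c * e by apply: ce.
have ea : e * a = a * e by apply: ce.
pose w := a - c.
have sw : ustar w = w by rewrite ustarB sc pa.1.
have ew : e * w = w * e by rewrite mulrBl mulrBr ec ea.
have aw : a * w = w * a by rewrite mulrBl mulrBr ac.
have cw : c * w = - (a * w) by rewrite !mulrBr aa ac opprB.
pose v := e * w; have sv : ustar v = v by rewrite ustarM sw pe.1.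
pose d := b * w.
have dd : ustar d * d = - (v * v).
  rewrite ustarM sw -mulrA [ustar b * _]mulrA -/c cw mulrN; congr -%R.
  by rewrite /v {1}ew -mulrA [e * (e * w)]mulrA ee.
have nd : upos (- (d * ustar d)).
  by apply: upos_neg_swap; rewrite dd opprK; exact: upos_sq.
pose p := d + ustar d; pose q := 'i *: (d - ustar d).
have sp : ustar p = p by rewrite ustarD ustarK addrC.
have sq : ustar q = q by rewrite ustarZ ustarB ustarK conjCi scaleNr -scalerN opprB.
have dE : ustar d * d = (2^-1)%:C%C *: (p * p + q * q) - d * ustar d.
  have -> : p * p + q * q = (ustar d * d + d * ustar d) + (ustar d * d + d * ustar d).
    rewrite -scalerAl -scalerAr scalerA -(expr2 'i) sqrCi scaleN1r.
    have -> : p * p = d * d + d * ustar d + (ustar d * d + ustar d * ustar d).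
      by rewrite mulrDl !mulrDr.
    rewrite mulrBl !mulrBr !opprB !addrA.
    by rewrite [LHS](ACl (3*2*5*7*4*6*1*8)) /= !addrK.
  by rewrite scalerDr halfD addrK.
(* Now [d^* d = - v^2] is positive as well, so [|t + v^2| <= t], which [unorm_real_add_sq] allows
   only for [v = 0]. Then [w^2 = 2 a w = 2 e v = 0]. *)
have [_ [t t0 ht]] : upos (ustar d * d).
  rewrite dE; apply: uposD nd; apply: uposZ; first by rewrite invr_ge0.
  by apply: uposD; exact: upos_sq.
have v0 : v = 0.
  apply: unorm_eq0; apply/eqP; rewrite -sqrf_eq0; apply/eqP/le_anti.
  rewrite sqr_ge0 andbT -(lerD2l t) addr0.
  by apply: le_trans (unorm_real_add_sq t0 sv) _; rewrite -[v * v]opprK -dd.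
have aw0 : a * w = 0 by rewrite -ee -mulrA -/v v0 mulr0.
have w0 : w = 0.
  by apply: sq_eq0 => //; rewrite {1}/w mulrBl cw aw0 oppr0 subr0.
by rewrite -(subr0_eq w0).
Qed.

(** If [|t - k| <= t], then [t + |h| <= |t + h| <= |t - k| + |h + k|]. All column estimates below
    use positivity in this form. *)
Lemma unorm_uposDl h k : upos h -> upos k -> unorm h <= unorm (h + k).
Proof.
move=> ph [_ [t t0 kt]].
have [v [[sv _] <- _]] := upos_sqrt ph.
rewrite -(lerD2l t) unorm_sq //; apply: le_trans (unorm_real_add_sq t0 sv) _.
have -> : t%:U + v * v = (t%:U - k) + (v * v + k).
  by rewrite [v * v + k]addrC addrA subrK.
exact: le_trans (unormD _ _) (lerD kt (lexx _)).
Qed.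

End CstarPositivity.

(** * The column module of a Hilbert module *)

Section HilbertModules.
Context {R : realType} {A : cstarAlgType R} {E : hilbertModType A}.
Implicit Types (x y : E) (a b : A).

Lemma innerDl x y (z : E) : inner (x + y) z = inner x z + inner y z.
Proof. by rewrite -inner_sym innerDr cstarD !inner_sym. Qed.

Lemma innerZl (c : R[i]) x y : inner (c *: x) y = (c^*)%R *: inner x y.
Proof. by rewrite -inner_sym innerZr cstarZ inner_sym. Qed.

Lemma inner_actl x y a : inner (act x a) y = cmul (cstar a) (inner x y).
Proof. by rewrite -inner_sym inner_actr cstarM inner_sym. Qed.

Lemma inner0r x : inner x (0 : E) = 0.
Proof. by rewrite -[X in inner _ X](scale0r (0 : E)) innerZr scale0r. Qed.

Lemma inner0l x : inner (0 : E) x = 0.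
Proof. by rewrite -inner_sym inner0r cstar0. Qed.

Lemma act0r x : act x (0 : A) = 0.
Proof. by rewrite -[X in act _ X](scale0r (0 : A)) actZr scale0r. Qed.

Lemma actNr x a : act x (- a) = - act x a.
Proof. by rewrite -scaleN1r actZr scaleN1r. Qed.

Lemma actBr x a b : act x (a - b) = act x a - act x b.
Proof. by rewrite actDr actNr. Qed.

Lemma rnorm_inner x : rnorm (inner x x) = rnorm x ^+ 2.
Proof.
by apply: complexI; rewrite rmorphXn /= -!rnormE norm_inner sqrtCK.
Qed.

Lemma rnorm_act x a : rnorm (act x a) <= rnorm x * rnorm a.
Proof.
rewrite -(@ler_pXn2r _ 2) // ?nnegrE ?mulr_ge0 ?rnorm_ge0 //.
rewrite -rnorm_inner inner_actr inner_actl exprMn -rnorm_inner.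
apply: le_trans (rnorm_cmul _ _) _; rewrite expr2 mulrA ler_wpM2r ?rnorm_ge0 //.
by apply: le_trans (rnorm_cmul _ _) _; rewrite rnorm_cstar mulrC.
Qed.

End HilbertModules.

HB.lock Definition inner2 (R : realType) (A : cstarAlgType R)
  (E : hilbertModType A) (x y : E * E) : A := inner x.1 y.1 + inner x.2 y.2.
Arguments inner2 {R A E} x y.

Lemma inner2E (R : realType) (A : cstarAlgType R) (E : hilbertModType A)
  (x y : E * E) : inner2 x y = inner x.1 y.1 + inner x.2 y.2.
Proof. by rewrite unlock. Qed.

Section Columns.
Context {R : realType} {A : cstarAlgType R} {E : hilbertModType A}.
Local Notation V := (E * E)%type.
Implicit Types (x y z h : V) (a b : A) (t : R).

Definition act2 x a : V := (act x.1 a, act x.2 a).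
Definition sqnorm2 x : R := rnorm (inner2 x x).

Lemma inner2Dr x y z : inner2 x (y + z) = inner2 x y + inner2 x z.
Proof. by rewrite !inner2E /= !innerDr addrACA. Qed.

Lemma inner2Dl x y z : inner2 (x + y) z = inner2 x z + inner2 y z.
Proof. by rewrite !inner2E /= !innerDl addrACA. Qed.

Lemma inner2Zr (c : R[i]) x y : inner2 x (c *: y) = c *: inner2 x y.
Proof. by rewrite !inner2E /= !innerZr scalerDr. Qed.

Lemma inner2Zl (c : R[i]) x y : inner2 (c *: x) y = (c^*)%R *: inner2 x y.
Proof. by rewrite !inner2E /= !innerZl scalerDr. Qed.

Lemma inner2Nr x y : inner2 x (- y) = - inner2 x y.
Proof. by rewrite -scaleN1r inner2Zr scaleN1r. Qed.

Lemma inner2Nl x y : inner2 (- x) y = - inner2 x y.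
Proof. by rewrite -scaleN1r inner2Zl rmorphN rmorph1 scaleN1r. Qed.

Lemma inner2_actr x y a : inner2 x (act2 y a) = cmul (inner2 x y) a.
Proof. by rewrite !inner2E /= !inner_actr cmulDl. Qed.

Lemma inner2_actl x y a : inner2 (act2 x a) y = cmul (cstar a) (inner2 x y).
Proof. by rewrite !inner2E /= !inner_actl cmulDr. Qed.

Lemma inner2_sym x y : cstar (inner2 x y) = inner2 y x.
Proof. by rewrite !inner2E cstarD !inner_sym. Qed.

(** The axiom only provides the shape [b^* b], which is not visibly stable under sums; the inner
    product of columns is such a sum. *)
Lemma upos_inner (e : E) : upos (uinj (inner e e)).
Proof.
by have [b ->] := inner_ge0 e; rewrite uinjM -ustar_inj; exact: upos_star_mul.
Qed.

Lemma upos_inner2 x : upos (uinj (inner2 x x)).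
Proof. by rewrite inner2E uinjD; apply: uposD; exact: upos_inner. Qed.

Lemma sqnorm2_ge0 x : 0 <= sqnorm2 x. Proof. exact: rnorm_ge0. Qed.

Lemma sqnorm2Z (c : R[i]) x : sqnorm2 (c *: x) = cabs c ^+ 2 * sqnorm2 x.
Proof.
rewrite /sqnorm2 inner2Zl inner2Zr scalerA rnormZ -/(cabs _) cabsM cabs_conj.
by rewrite expr2.
Qed.

Lemma sqnorm2_fst x : rnorm x.1 ^+ 2 <= sqnorm2 x.
Proof.
rewrite -rnorm_inner -[rnorm _]unorm_inj /sqnorm2 -[leRHS]unorm_inj inner2E uinjD.
by apply: unorm_uposDl; exact: upos_inner.
Qed.

Lemma sqnorm2_snd x : rnorm x.2 ^+ 2 <= sqnorm2 x.
Proof.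
rewrite -rnorm_inner -[rnorm _]unorm_inj /sqnorm2 -[leRHS]unorm_inj inner2E addrC uinjD.
by apply: unorm_uposDl; exact: upos_inner.
Qed.

(** The parallelogram identity with the positive [<x - y, x - y>] dropped. For midpoints its
    constant is sharp enough: [2 (1/4 + 1/4) = 1]. *)
Lemma sqnorm2D x y : sqnorm2 (x + y) <= 2 * (sqnorm2 x + sqnorm2 y).
Proof.
have par : inner2 (x + y) (x + y) + inner2 (x - y) (x - y) =
    (inner2 x x + inner2 y y) + (inner2 x x + inner2 y y).
  rewrite !inner2Dl !inner2Dr !inner2Nl !inner2Nr opprK !addrA.
  by rewrite [LHS](ACl (1*4*5*8*2*6*3*7)) /= !addrK.
rewrite /sqnorm2 -unorm_inj.
apply: le_trans (unorm_uposDl (upos_inner2 (x + y)) (upos_inner2 (x - y))) _.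
rewrite -uinjD par unorm_inj mulrDl mul1r.
by apply: le_trans (rnormD _ _) (lerD _ _); exact: rnormD.
Qed.

Lemma sqnorm2_act x a : sqnorm2 (act2 x a) <= rnorm a ^+ 2 * sqnorm2 x.
Proof.
rewrite /sqnorm2 inner2_actl inner2_actr; apply: le_trans (rnorm_cmul _ _) _.
rewrite rnorm_cstar expr2 -mulrA ler_wpM2l ?rnorm_ge0 // mulrC.
exact: rnorm_cmul.
Qed.

Lemma sqrt_one_sub_inner2 x : sqnorm2 x <= 1 ->
  exists k : unitization A, [/\ ustar k = k, unorm k <= 1 &
    uinj (inner2 x x) + k * k = 1].
Proof.
move=> x1; have [u [[su _] uu _]] := upos_sqrt (upos_inner2 x).
have u1 : unorm u <= 1.
  by rewrite -(@expr_le1 _ 2) ?unorm_ge0 // -unorm_sq // uu unorm_inj.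
have [k [sk uk ck]] := sqrt_one_sub_sq su u1; exists k; split=> //; last by rewrite -uu.
rewrite -(@expr_le1 _ 2) ?unorm_ge0 //; apply: le_trans (unorm_sq_addl sk su _) _.
  exact: ck.
by rewrite addrC uk unorm1.
Qed.

(** With [c = <x, h>] and [k^2 = 1 - <x, x>], [<h, h>] is the sum of [c^* c], [<x c - h, x c - h>]
    and [(k c)^* (k c)], all positive; the first is kept. *)
Lemma cauchy_schwarz2 x h : sqnorm2 x <= 1 -> rnorm (inner2 x h) ^+ 2 <= sqnorm2 h.
Proof.
move=> /sqrt_one_sub_inner2[k [sk _ pk]].
pose c := inner2 x h; pose z := act2 x c - h; pose p := uinj (inner2 x x).
have hE : uinj (inner2 h h) = uinj (cmul (cstar c) c) +
    (uinj (inner2 z z) + ustar (k * uinj c) * (k * uinj c)).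
  rewrite ustarM sk -mulrA [k * (k * _)]mulrA.
  have -> : k * k = 1 - p by rewrite -pk addrAC subrr add0r.
  rewrite mulrBl mul1r mulrBr !ustar_inj.
  have -> : inner2 z z = cmul (cmul (cstar c) (inner2 x x)) c - cmul (cstar c) c -
      cmul (cstar c) c + inner2 h h.
    rewrite !inner2Dl !inner2Dr !inner2Nl !inner2Nr opprK inner2_actr inner2_actl.
    by rewrite inner2_actl inner2_actr -[inner2 h x]inner2_sym -/c !addrA.
  rewrite !uinjD !uinjN !uinjM -/p.
  move: (uinj (cstar c) * uinj c) (uinj (inner2 h h)) => q r; rewrite !mulrA.
  move: (_ * p * _) => s; rewrite !addrA.
  by rewrite [RHS](ACl (5*1*3*6*4*2*7)) /=; rewrite !addrK.
rewrite -rnorm_cstar_cmul -[leLHS]unorm_inj /sqnorm2 -[leRHS]unorm_inj hE.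
apply: unorm_uposDl; first by rewrite uinjM -ustar_inj; exact: upos_star_mul.
by apply: uposD; [exact: upos_inner2|exact: upos_star_mul].
Qed.

(* The vector field [x |-> h - x <h, x>] is tangent to the unit sphere:
   writing [p = <x, x>], [1 - p = k^2] and [b = <x, h>], the inner square of
   [x + t (h - x <h, x>)] is [1 - (1 - t b) k^2 (1 - t b)^* + O(t^2)]. *)
Lemma tangent_field x h t : sqnorm2 x <= 1 ->
  sqnorm2 (x + t%:C%C *: (h - act2 x (inner2 h x))) <= 1 + 5 * sqnorm2 h * t ^+ 2.
Proof.
move=> x1; have [k [sk k1 pk]] := sqrt_one_sub_inner2 x1.
set f := h - _; set Y := x + _.
pose p := uinj (inner2 x x); pose b := uinj (inner2 x h); pose H := uinj (inner2 f f).
pose q := k * k; pose T : R[i] := t%:C%C.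
have bE : ustar b = uinj (inner2 h x) by rewrite ustar_inj inner2_sym.
pose m := (1 - T *: b) * k.
have xf : uinj (inner2 x f) = b - p * ustar b.
  by rewrite inner2Dr inner2Nr inner2_actr uinjD uinjN uinjM bE.
have fx : uinj (inner2 f x) = ustar b - b * p.
  rewrite inner2Dl inner2Nl inner2_actl uinjD uinjN uinjM -bE.
  by rewrite inner2_sym.
have YE : uinj (inner2 Y Y) = p + T *: (b - p * ustar b) + T *: (ustar b - b * p) + (T * T) *: H.
  rewrite inner2Dl !inner2Dr !inner2Zl !inner2Zr conjC_real !uinjD !uinjZ xf fx.
  by rewrite scalerA !addrA.
have pE : p = 1 - q by rewrite -pk addrK.
have key : uinj (inner2 Y Y) + m * ustar m = 1 + (T * T) *: (H + b * q * ustar b).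
  rewrite YE ustarM ustarB ustarZ conjC_real ustar1 sk -/T.
  have -> : (1 - T *: b) * k * (k * (1 - T *: ustar b)) =
      q - T *: (b * q) - T *: (q * ustar b) + (T * T) *: (b * q * ustar b).
    rewrite -mulrA [k * (k * _)]mulrA -/q mulrA mulrBl mul1r -scalerAl.
    rewrite mulrBr mulr1 mulrBl -!scalerAl -!scalerAr scalerA -!mulrA opprB.
    by rewrite addrA addrAC.
  have -> : b - p * ustar b = b - ustar b + q * ustar b.
    by rewrite pE mulrBl mul1r opprB addrA addrAC.
  have -> : ustar b - b * p = ustar b - b + b * q.
    by rewrite pE mulrBr mulr1 opprB addrA addrAC.
  rewrite pE !scalerDr scalerN scalerN.
  move: (T *: b) (T *: ustar b) (T *: (q * _)) (T *: (b * q)) => b1 b2 q1 q2.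
  move: (_ *: H) (_ *: (b * q * _)) => c1 c2; rewrite !addrA.
  by rewrite [LHS](ACl (1*9*13*10*2*3*7*6*4*5*12*8*11)) /= !addrK.
rewrite /sqnorm2 -unorm_inj.
apply: le_trans (unorm_uposDl (upos_inner2 Y) (_ : upos (m * ustar m))) _.
  by rewrite -{1}[m]ustarK; exact: upos_star_mul.
rewrite key; apply: le_trans (unormD _ _) _; rewrite unorm1 lerD2l.
rewrite -rmorphM /= unormZ -expr2 ?sqr_ge0 // mulrC ler_wpM2r ?sqr_ge0 //.
(* The constant 5: [|H| <= 2 (|h|^2 + |b|^2) <= 4 |h|^2], and [b q b^*] adds one more [|h|^2]. *)
have bb : unorm b ^+ 2 <= sqnorm2 h by rewrite unorm_inj cauchy_schwarz2.
have q1 : unorm q <= 1.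
  by apply: le_trans (unormM _ _) _; rewrite -expr2 expr_le1 ?unorm_ge0.
have bqb : unorm (b * q * ustar b) <= unorm b ^+ 2.
  apply: le_trans (unormM _ _) _; rewrite unorm_star expr2 ler_wpM2r ?unorm_ge0 //.
  by apply: le_trans (unormM _ _) _; rewrite ler_piMr ?unorm_ge0.
have HH : unorm H <= 2 * (sqnorm2 h + unorm b ^+ 2).
  rewrite unorm_inj; apply: le_trans (sqnorm2D _ _) _.
  rewrite ler_wpM2l // lerD2l -scaleN1r sqnorm2Z.
  rewrite [cabs _](@rnormN _ (R[i]^o)) -/(cabs 1) cabs1 expr1n mul1r.
  apply: le_trans (sqnorm2_act _ _) _; rewrite -inner2_sym rnorm_cstar unorm_inj.
  by rewrite ler_piMr ?sqr_ge0.
by have := unormD H (b * q * ustar b); lra.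
Qed.

End Columns.

(** * Quadratic fields tangent to the sphere *)

Section Liouville.
Context {R : realType} {V : lmodType R[i]} {W : normedModType R[i]}.
Implicit Types (s : seq (nat * V)) (y : V).

(** Averages over roots of unity will replace the Cauchy integral; iterated square roots of -1 give
    orders as large as desired. *)
Lemma prim_root_exp2 n : exists z : R[i], (2 ^ n.+1).-primitive_root z.
Proof.
have [z zn] : exists z : R[i], z ^+ (2 ^ n) = -1.
  elim: n => [|n [z zn]]; first by exists (-1); rewrite expr1.
  by exists (sqrtC z); rewrite expnS exprM sqrtCK.
exists z; have z1 : z ^+ (2 ^ n.+1) = 1 by rewrite expnS mulnC exprM zn sqrrN expr1n.
have [|m pm] := prim_order_exists _ z1; first by rewrite expn_gt0.
case/(dvdn_pfactor _ _ (isT : prime 2)) => k kn mE; move: pm; rewrite mE.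
case: (ltngtP k n.+1) kn => // [kn _|-> //] /prim_order_dvd/(_ (2 ^ n)%N).
by rewrite dvdn_exp2l // zn eq_sym -addr_eq0 -mulr2n pnatr_eq0.
Qed.

(** Polynomials in [l] with coefficients in [V] are lists of pairs (degree, coefficient),
    repetitions allowed, so that an Euler step merely appends monomials. *)
Definition peval s (l : R[i]) : V := \sum_(q <- s) l ^+ q.1 *: q.2.
Definition pcoef s n : V := \sum_(q <- s | q.1 == n) q.2.

Lemma sum_prim_root n (z : R[i]) k : n.+1.-primitive_root z ->
  \sum_(j < n.+1) (z ^+ j) ^+ k = (if (n.+1 %| k)%N then n.+1%:R else 0).
Proof.
move=> pz; have zk j : (z ^+ j) ^+ k = (z ^+ k) ^+ j by rewrite -!exprM mulnC.
under eq_bigr do rewrite zk.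
rewrite (prim_order_dvd pz); case: eqP => [->|/eqP zk1].
  by under eq_bigr do rewrite expr1n; rewrite sumr_const card_ord.
apply/eqP; rewrite -(mulrI_eq0 _ (mulfI (_ : z ^+ k - 1 != 0))) ?subr_eq0 //.
by rewrite -subrX1 -exprM mulnC exprM (prim_expr_order pz) expr1n subrr.
Qed.

(** Discrete Fourier inversion: the weight [n + 1] is -1 modulo the order [n + 2], so only degree 1
    survives the sum among degrees below [n + 2]. *)
Lemma pcoef_extract s n (z l : R[i]) : n.+2.-primitive_root z ->
    all (fun q => q.1 < n.+2)%N s ->
  \sum_(j < n.+2) (z ^+ j) ^+ n.+1 *: peval s (l * z ^+ j) =
    (n.+2%:R * l) *: pcoef s 1.
Proof.
move=> pz /allP sn; rewrite /pcoef scaler_sumr [RHS]big_mkcond /=.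
under eq_bigr do rewrite /peval scaler_sumr.
rewrite exchange_big /= big_seq [RHS]big_seq; apply: eq_bigr => q /sn qn.
under eq_bigr do rewrite exprMn scalerA mulrCA -exprD.
rewrite -scaler_suml -mulr_sumr sum_prim_root //.
case: ifP => [dv|]; last case: eqP => [-> |]; rewrite ?mulr0 ?scale0r //.
  have -> : q.1 = 1%N; last by rewrite eqxx expr1 mulrC.
  by case: q qn dv => k v /= kn /dvdnP[[|[|j]] dv]; nia.
by rewrite addn1 dvdnn.
Qed.

Lemma cauchy_estimate (f : {linear V -> W}) s (r K : R) : 0 <= r ->
    (forall l, cabs l = r -> rnorm (f (peval s l)) <= K) ->
  r * rnorm (f (pcoef s 1)) <= K.
Proof.
move=> r0 fK; pose d := \max_(q <- s) q.1.
have [z pz] := prim_root_exp2 d.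
have : (2 ^ d.+1 = (2 ^ d.+1 - 2).+2)%N.
  by rewrite -[RHS]addn2 subnK // expnS leq_pmulr // expn_gt0.
set n := (_ - 2)%N => nE; rewrite nE in pz.
have sn : all (fun q => q.1 < n.+2)%N s.
  apply/allP => q qs; rewrite -nE; apply: leq_ltn_trans (_ : d < _)%N.
    by apply: (@leq_bigmax_seq _ s xpredT (fun q => q.1) q qs isT).
  by apply: ltn_trans (ltnSn _) (ltn_expl _ _).
have := congr1 f (pcoef_extract (r%:C%C) pz sn); rewrite linear_sum linearZ /=.
move/(congr1 (@rnorm _ _)); rewrite rnormZ -/(cabs _) cabsM cabs_nneg // => eqn.
have nn : cabs (n.+2%:R : R[i]) = n.+2%:R.
  by rewrite -(rmorph_nat (real_complex R)) cabs_nneg.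
have z1 : cabs z = 1.
  apply/eqP; rewrite -(@eqrXn2 _ n.+2) ?cabs_ge0 // expr1n -cabsX.
  by rewrite (prim_expr_order pz) cabs1.
have n0 : 0 < n.+2%:R :> R by rewrite ltr0n.
rewrite -(ler_pM2l n0) mulrA -{1}nn -eqn; apply: le_trans (rnorm_sum _) _.
rewrite mulr_natl -[X in _ *+ X]card_ord -sumr_const; apply: ler_sum => j _.
rewrite linearZ rnormZ -/(cabs _) !cabsX z1 !expr1n mul1r; apply: fK.
by rewrite cabsM cabsX z1 expr1n mulr1 cabs_nneg.
Qed.

(** [p] stands for a squared norm. [Bp] has no first-order term in [l]: this is tangency to spheres
    in every complex direction, and [p y ^+ 2] has degree 4 in [y], as does the squared size of a
    quadratic field. *)
Variables (B : V -> V -> V) (f : {linear V -> W}) (p : V -> R) (C : R).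
Hypotheses (C0 : 0 <= C)
  (BDl : forall x y z, B (x + y) z = B x z + B y z)
  (BDr : forall x y z, B x (y + z) = B x y + B x z)
  (BZl : forall c x y, B (c *: x) y = c *: B x y)
  (BZr : forall c x y, B x (c *: y) = c *: B x y)
  (fp : forall y, rnorm (f y) ^+ 2 <= p y)
  (Bp : forall y l, p (y + l *: B y y) <= p y + C * cabs l ^+ 2 * p y ^+ 2).

Let B_suml (I : Type) (t : seq I) (P : pred I) (F : I -> V) y :
  B (\sum_(i <- t | P i) F i) y = \sum_(i <- t | P i) B (F i) y.
Proof.
elim/big_rec2: _ => [|i a b _ <-]; last by rewrite BDl.
by rewrite -[X in B X _](scale0r (0 : V)) BZl scale0r.
Qed.

Let B_sumr (I : Type) (t : seq I) (P : pred I) (F : I -> V) y :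
  B y (\sum_(i <- t | P i) F i) = \sum_(i <- t | P i) B y (F i).
Proof.
elim/big_rec2: _ => [|i a b _ <-]; last by rewrite BDr.
by rewrite -[X in B _ X](scale0r (0 : V)) BZr scale0r.
Qed.

Let estep (m : R[i]) s :=
  s ++ [seq ((q.1 + q'.1).+1, m *: B q.2 q'.2) | q <- s, q' <- s].

Let estep_eval m s l :
  peval (estep m s) l = peval s l + (m * l) *: B (peval s l) (peval s l).
Proof.
rewrite /peval big_cat /= big_allpairs_dep /= B_suml scaler_sumr; congr +%R.
apply: eq_bigr => q _; rewrite B_sumr scaler_sumr; apply: eq_bigr => q' _.
by rewrite BZl BZr !scalerA exprS exprD; congr (_ *: _); ring.
Qed.

Let estep_coef0 m s : pcoef (estep m s) 0 = pcoef s 0.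
Proof.
rewrite /pcoef big_cat /= [X in _ + X]big1_seq ?addr0 // => q /andP[/eqP q0].
by case/allpairsP => qq [_ _ qE]; rewrite qE in q0.
Qed.

Let estep_coef1 m s :
  pcoef (estep m s) 1 = pcoef s 1 + m *: B (pcoef s 0) (pcoef s 0).
Proof.
rewrite /pcoef big_cat /=; congr +%R.
rewrite B_suml scaler_sumr big_mkcond big_allpairs_dep /= [RHS]big_mkcond /=.
apply: eq_bigr => q _; case: (q.1 =P 0%N) => [->|/eqP q0].
  rewrite B_sumr scaler_sumr [RHS]big_mkcond /=; apply: eq_bigr => q' _.
  by rewrite add0n eqSS.
by rewrite big1 // => q' _; rewrite eqSS addn_eq0 (negPf q0).
Qed.

(* Run the Euler scheme of [y' = l B y y] for unit time in [n] steps: the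
   iterate is a polynomial in [l] with linear coefficient [B y y], bounded on
   [|l| = r] uniformly in [r] once [n] is large. *)
Lemma tangent_quadratic_eq0 y : f (B y y) = 0.
Proof.
have p0 z : 0 <= p z by apply: le_trans (fp z); rewrite sqr_ge0.
pose K := p y; have K0 : 0 <= K := p0 y.
suff est (r : R) : 0 <= r -> r * rnorm (f (B y y)) <= K + 1.
  apply: rnorm_eq0; apply/le_anti; rewrite rnorm_ge0 andbT leNgt; apply/negP => f0.
  have := est ((K + 2) / rnorm (f (B y y))).
  rewrite divr_ge0 ?addr_ge0 ?(ltW f0) // divfK ?gt_eqF // => /(_ isT); lra.
(* While [p <= K + 1], a step of size [1 / n] on [|l| = r] raises [p] by at most [D / n^2]; as
   [n >= D], all [n] steps raise it by at most 1, and the bound sustains itself. *)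
move=> r0; pose D := C * r ^+ 2 * (K + 1) ^+ 2.
have D0 : 0 <= D by rewrite /D !mulr_ge0 // addr_ge0.
pose n := (Num.bound D).+1; have Dn : D <= n%:R.
  by apply: ltW; apply: lt_trans (Num.Theory.archi_boundP D0) _; rewrite ltr_nat.
have n0 : 0 < n%:R :> R by rewrite ltr0n.
pose m : R := n%:R^-1; have m0 : 0 <= m by rewrite invr_ge0 ltW.
pose s j := iter j (estep m%:C%C) [:: (0%N, y)].
have s0 j : pcoef (s j) 0 = y.
  elim: j => [|j IH]; last by rewrite /s iterS estep_coef0.
  by rewrite /pcoef big_cons big_nil addr0.
have s1 j : pcoef (s j) 1 = (j%:R * m)%:C%C *: B y y.
  elim: j => [|j IH]; first by rewrite /pcoef big_cons big_nil mul0r scale0r.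
  by rewrite /s iterS estep_coef1 -/(s j) IH s0 -scalerDl -rmorphD /= -natr1 mulrDl mul1r.
have sp j l : cabs l = r -> (j <= n)%N -> p (peval (s j) l) <= K + j%:R * (m ^+ 2 * D).
  move=> lr; elim: j => [_|j IH jn].
    by rewrite /peval big_seq1 expr0 scale1r mul0r addr0.
  have {}IH := IH (ltnW jn).
  rewrite /s iterS estep_eval -/(s j); apply: le_trans (Bp _ _) _.
  have le1 : p (peval (s j) l) <= K + 1.
    apply: le_trans IH _; rewrite lerD2l mulrCA.
    apply: le_trans (_ : m ^+ 2 * (n%:R * n%:R) <= _).
      by rewrite ler_wpM2l ?sqr_ge0 // ler_pM // ler_nat ltnW.
    by rewrite expr2 mulrACA mulVf ?gt_eqF // mulr1.
  rewrite cabsM cabs_nneg // lr -[j.+1%:R]natr1 mulrDl mul1r addrA lerD //.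
  have -> : m ^+ 2 * D = C * (m * r) ^+ 2 * (K + 1) ^+ 2 by rewrite /D; ring.
  apply: ler_wpM2l; first by rewrite mulr_ge0 ?sqr_ge0.
  by rewrite ler_pXn2r ?nnegrE ?addr_ge0.
have -> : B y y = pcoef (s n) 1 by rewrite s1 divff ?gt_eqF // scale1r.
apply: cauchy_estimate => // l lr.
have := le_trans (fp _) (sp n l lr (leqnn n)).
have : n%:R * (m ^+ 2 * D) <= 1.
  rewrite expr2 mulrA mulrA divff ?gt_eqF // mul1r mulrC ler_pdivrMr ?mul1r //.
move: (rnorm_ge0 (f (peval (s n) l))); move: (rnorm _) (n%:R * _) => a b; nra.
Qed.

End Liouville.

(** * Isometries preserve the ternary product *)

Section ColumnNorm.
Context {R : realType} {A : cstarAlgType R} {E : hilbertModType A}.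
Implicit Types x : (E * E)%type.

Definition colmx2 x : 'M[E]_2 :=
  \matrix_(i, j) (if j == 0 then if i == 0 then x.1 else x.2 else 0).

Lemma cvnorm2 (a : 'cV[A]_2) : cvnorm a =
  Num.sqrt (rnorm (cmul (cstar (a 0 0)) (a 0 0) + cmul (cstar (a 1 0)) (a 1 0))).
Proof.
rewrite /cvnorm big_ord_recl big_ord1; congr (Num.sqrt (rnorm (_ + _))).
by congr (cmul (cstar (a _ _)) (a _ _)); apply/val_inj.
Qed.

(** The inner square has [p] in one corner and 0 elsewhere, so its norm is that of left
    multiplication by [p], attained at [p^* / |p|] even without a unit. *)
Lemma mxmodnorm_col x : mxmodnorm (colmx2 x) = Num.sqrt (sqnorm2 x).
Proof.
congr Num.sqrt; rewrite /cmxnorm /sqnorm2; set M := mxinner _ _; set p := inner2 x x.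
have ME (a : 'cV[A]_2) : cvnorm (cmulmxv M a) = rnorm (cmul p (a 0 0)).
  have M0 i j : M i j = if (i == 0) && (j == 0) then p else 0.
    rewrite mxE big_ord_recl big_ord1 !mxE /p inner2E.
    by case: (i == 0); case: (j == 0); rewrite /= ?inner0r ?inner0l ?addr0.
  rewrite cvnorm2 !mxE !big_ord_recl !big_ord0 !M0 /=.
  by rewrite !cmul0l !addr0 cmul0r addr0 rnorm_cstar_cmul sqrtr_sqr ger0_norm ?rnorm_ge0.
have a1 (a : 'cV[A]_2) : cvnorm a <= 1 -> rnorm (a 0 0) <= 1.
  rewrite cvnorm2 => le1; rewrite -(@expr_le1 _ 2) ?rnorm_ge0 //.
  rewrite -rnorm_cstar_cmul; set s := _ + _ in le1.
  have s1 : rnorm s <= 1.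
    by rewrite -[rnorm s]sqr_sqrtr ?rnorm_ge0 // expr_le1 ?sqrtr_ge0.
  apply: le_trans s1; rewrite -!unorm_inj /s uinjD.
  by apply: unorm_uposDl; rewrite uinjM -ustar_inj; exact: upos_star_mul.
apply/le_anti/andP; split.
  apply: ge_sup.
    exists (cvnorm (cmulmxv M 0)), 0 => //=.
    by rewrite cvnorm2 !mxE cmul0r addr0 rnorm0 sqrtr0 ler01.
  move=> _ [a /= /a1 le1 <-]; rewrite ME; apply: le_trans (rnorm_cmul _ _) _.
  by rewrite ler_piMr ?rnorm_ge0.
have ub : has_ubound [set cvnorm (cmulmxv M a) | a in [set a | cvnorm a <= 1]]%classic.
  exists (rnorm p) => _ [a /= /a1 le1 <-]; rewrite ME; apply: le_trans (rnorm_cmul _ _) _.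
  by rewrite ler_piMr ?rnorm_ge0.
pose c : R[i] := ((rnorm p)^-1)%:C%C.
(* If [p = 0], the inverse in [c] is 0 by convention and [a = 0] still serves. *)
pose a : 'cV[A]_2 := \col_i (if i == 0 then c *: cstar p else 0).
have cc : cabs c = (rnorm p)^-1 by rewrite cabs_nneg // invr_ge0 rnorm_ge0.
have -> : rnorm p = cvnorm (cmulmxv M a).
  rewrite ME mxE /= cmulZr rnormZ -/(cabs _) cc rnorm_cmul_cstar expr2.
  have [->|p0] := eqVneq (rnorm p) 0; first by rewrite !mulr0.
  by rewrite mulKf.
apply: ub_le_sup => //; exists a => //=; rewrite cvnorm2 !mxE /= cmul0r addr0.
rewrite rnorm_cstar_cmul sqrtr_sqr ger0_norm ?rnorm_ge0 // rnormZ -/(cabs _) cc rnorm_cstar.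
have [->|p0] := eqVneq (rnorm p) 0; first by rewrite mulr0 ler01.
by rewrite mulVf.
Qed.

End ColumnNorm.

Section Ternary.
Context {R : realType} {A B : cstarAlgType R}.
Context {E : hilbertModType A} {F : hilbertModType B}.
Variables (T : {linear E -> F}) (S : {linear F -> E}).
Hypothesis SK : cancel S T.

Let T2 (x : (E * E)%type) : (F * F)%type := (T x.1, T x.2).
Let S2 (y : (F * F)%type) : (E * E)%type := (S y.1, S y.2).
Hypothesis T2_iso : forall x, sqnorm2 (T2 x) = sqnorm2 x.

Let T2D x y : T2 (x + y) = T2 x + T2 y.
Proof. by rewrite /T2 /= !linearD. Qed.

Let T2Z c x : T2 (c *: x) = c *: T2 x.
Proof. by rewrite /T2 /= !linearZ. Qed.

Let T2S2 y : T2 (S2 y) = y.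
Proof. by rewrite /T2 /S2 /= !SK; case: y. Qed.

Section Difference.
Variable a : (E * E)%type.

(** The conjugate-linear slot of the inner product is taken by the fixed [a]; this is why [D] is
    complex bilinear. *)
Let D (x y : (E * E)%type) : (E * E)%type :=
  S2 (act2 (T2 x) (inner2 (T2 a) (T2 y))) - act2 x (inner2 a y).

Let S2D x y : S2 (x + y) = S2 x + S2 y.
Proof. by rewrite /S2 /= !linearD. Qed.

Let S2Z c x : S2 (c *: x) = c *: S2 x.
Proof. by rewrite /S2 /= !linearZ. Qed.

Let DDl x y z : D (x + y) z = D x z + D y z.
Proof.
rewrite /D T2D [RHS]addrACA -S2D -opprD.
by congr (S2 _ - _); rewrite /act2 /= !actDl.
Qed.

Let DDr x y z : D x (y + z) = D x y + D x z.
Proof.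
rewrite /D T2D [RHS]addrACA -S2D -opprD.
by congr (S2 _ - _); rewrite inner2Dr /act2 /= !actDr.
Qed.

Let DZl c x y : D (c *: x) y = c *: D x y.
Proof.
rewrite /D T2Z scalerBr -S2Z.
by congr (S2 _ - _); rewrite /act2 /= !actZl.
Qed.

Let DZr c x y : D x (c *: y) = c *: D x y.
Proof.
rewrite /D T2Z scalerBr -S2Z.
by congr (S2 _ - _); rewrite inner2Zr /act2 /= !actZr.
Qed.

Let C := 20 * sqnorm2 a.

(** [x + t D x x] is the midpoint of moves by [2 t] along the field of [E^2] and by [- 2 t] along
    the pulled-back one. The doubled time turns the 5 of [tangent_field] into the 20 of [C]. *)
Let D_tangent x (t : R) : sqnorm2 x <= 1 ->
  sqnorm2 (x + t%:C%C *: D x x) <= 1 + C * t ^+ 2.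
Proof.
move=> x1; pose h1 := a - act2 x (inner2 a x).
pose h2 := a - S2 (act2 (T2 x) (inner2 (T2 a) (T2 x))).
have e1 : sqnorm2 (x + (2 * t)%:C%C *: h1) <= 1 + C * t ^+ 2.
  by apply: le_trans (tangent_field _ _ x1) _; rewrite /C; lra.
have e2 : sqnorm2 (x + (- (2 * t))%:C%C *: h2) <= 1 + C * t ^+ 2.
  rewrite -T2_iso T2D T2Z.
  have -> : T2 h2 = T2 a - act2 (T2 x) (inner2 (T2 a) (T2 x)).
    by rewrite /h2 -scaleN1r T2D T2Z T2S2 scaleN1r.
  apply: le_trans (tangent_field _ _ _) _; rewrite T2_iso // /C; lra.
have -> : x + t%:C%C *: D x x = (2^-1)%:C%C *: (x + (2 * t)%:C%C *: h1) +
    (2^-1)%:C%C *: (x + (- (2 * t))%:C%C *: h2).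
  have -> : D x x = h1 - h2 by rewrite /h1 /h2 opprB addrC subrKA.
  clearbody h1 h2; rewrite !scalerDr !scalerA -!rmorphM /= mulrN mulKf // rmorphN scaleNr.
  rewrite scalerN addrACA -scalerDl -rmorphD /= (_ : 2^-1 + 2^-1 = 1) ?rmorph1 ?scale1r //.
  by field.
apply: le_trans (sqnorm2D _ _) _.
rewrite !sqnorm2Z cabs_nneg ?invr_ge0 //; move: e1 e2.
move: (sqnorm2 (_ + _)) (sqnorm2 (_ + _)) => u v; lra.
Qed.

(** For [l = |l| u], apply the real case at [u x], where [D (u x) (u x) = u^2 D x x]. *)
Let D_tangentC x (l : R[i]) : sqnorm2 x <= 1 ->
  sqnorm2 (x + l *: D x x) <= 1 + C * cabs l ^+ 2.
Proof.
move=> x1.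
have [u u1 lE] : exists2 u : R[i], cabs u = 1 & l = (cabs l)%:C%C * u.
  have [l0|l0] := eqVneq l 0.
    by exists 1; rewrite ?cabs1 // l0 cabs0 mulr1.
  exists (l / `|l|); last by rewrite -cabsE mulrC divfK // normr_eq0.
  by apply: complexI; rewrite -cabsE normrM normfV normr_id divff // normr_eq0.
have := @D_tangent (u *: x) (cabs l); rewrite sqnorm2Z u1 expr1n mul1r => /(_ x1).
have -> : u *: x + (cabs l)%:C%C *: D (u *: x) (u *: x) = u *: (x + l *: D x x).
  rewrite DZl DZr; move: (D x x) => d; rewrite scalerDr !scalerA.
  by congr (_ + _ *: _); rewrite [in RHS]lE; ring.
by rewrite sqnorm2Z u1 expr1n mul1r.
Qed.

Let D_bound y (l : R[i]) :
  sqnorm2 (y + l *: D y y) <= sqnorm2 y + C * cabs l ^+ 2 * sqnorm2 y ^+ 2.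
Proof.
have [y0|y0] := eqVneq (sqnorm2 y) 0.
  have -> : y = 0.
    have := sqnorm2_fst y; have := sqnorm2_snd y; rewrite y0.
    case: y {y0} => y1 y2 /=; rewrite !real_exprn_even_le0 //= => /eqP h2 /eqP h1.
    by rewrite (rnorm_eq0 h1) (rnorm_eq0 h2).
  have -> : D 0 0 = 0 by rewrite -[X in D X _](scale0r 0) DZl scale0r.
  have -> : sqnorm2 (0 : (E * E)%type) = 0.
    by rewrite -[X in sqnorm2 X](scale0r 0) sqnorm2Z cabs0 expr0n mul0r.
  rewrite scaler0 addr0 -[X in sqnorm2 X](scale0r (0 : (E * E)%type)) sqnorm2Z cabs0 expr0n.
  by rewrite mul0r /= mulr0 addr0.
pose r := Num.sqrt (sqnorm2 y).
have r2 : r ^+ 2 = sqnorm2 y by rewrite sqr_sqrtr ?sqnorm2_ge0.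
have r0 : 0 < r by rewrite sqrtr_gt0 lt_def y0 sqnorm2_ge0.
pose x := (r^-1)%:C%C *: y.
have yE : y = r%:C%C *: x.
  by rewrite scalerA -rmorphM /= divff ?gt_eqF // rmorph1 scale1r.
have x1 : sqnorm2 x <= 1.
  rewrite sqnorm2Z cabs_nneg ?invr_ge0 ?(ltW r0) // -r2 -exprMn.
  by rewrite mulVf ?gt_eqF // expr1n.
clearbody x; have -> : y + l *: D y y = r%:C%C *: (x + (l * r%:C%C) *: D x x).
  rewrite [in LHS]yE DZl DZr; move: (D x x) => d; rewrite scalerDr !scalerA.
  by congr (_ + _ *: _); ring.
rewrite sqnorm2Z cabs_nneg ?(ltW r0) // -r2.
apply: le_trans (ler_wpM2l (sqr_ge0 _) (D_tangentC _ x1)) _.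
rewrite cabsM cabs_nneg ?(ltW r0) //.
by rewrite [leLHS](_ : _ = r ^+ 2 + C * cabs l ^+ 2 * r ^+ 2 ^+ 2) //; ring.
Qed.

Lemma snd_difference_eq0 x : (D x x).2 = 0.
Proof.
have C0 : 0 <= C by rewrite mulr_ge0 ?sqnorm2_ge0.
exact: (tangent_quadratic_eq0 (f := snd) C0 DDl DDr DZl DZr (@sqnorm2_snd _ _ _) D_bound).
Qed.

End Difference.

Lemma isometry_ternary (x y z : E) :
  T (act x (inner y z)) = act (T x) (inner (T y) (T z)).
Proof.
have /eqP := snd_difference_eq0 (y, 0) (z, x).
by rewrite subr_eq0 /= !inner2E /= linear0 !inner0l !addr0 => /eqP <-; rewrite SK.
Qed.

End Ternary.

(** * The induced isomorphism *)

Section CauchySchwarz.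
Context {R : realType} {A : cstarAlgType R} {E : hilbertModType A}.

Lemma rnorm_inner_le (x y : E) : rnorm (inner x y) <= rnorm x * rnorm y.
Proof.
have sq (z : E) : sqnorm2 (z, 0) = rnorm z ^+ 2.
  by rewrite /sqnorm2 inner2E /= inner0r addr0 rnorm_inner.
have [x0|x0] := eqVneq (rnorm x) 0.
  by rewrite (rnorm_eq0 x0) inner0l !rnorm0 mul0r.
have xV : cabs ((rnorm x)^-1)%:C%C = (rnorm x)^-1.
  by rewrite cabs_nneg // invr_ge0 rnorm_ge0.
have := @cauchy_schwarz2 _ _ _ (((rnorm x)^-1)%:C%C *: x, 0) (y, 0).
rewrite !sq inner2E /= inner0r addr0 innerZl !rnormZ -!/(cabs _) cabs_conj xV.
rewrite mulVf // expr1n lexx => /(_ isT).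
rewrite ler_pXn2r ?nnegrE ?mulr_ge0 ?invr_ge0 ?rnorm_ge0 //.
by rewrite ler_pdivrMl // lt_def x0 rnorm_ge0.
Qed.

End CauchySchwarz.

Lemma closure_rnorm (R : realType) (V : normedModType R[i]) (S : set V) (x : V) (e : R) :
  closure S x -> 0 < e -> exists2 u, S u & rnorm (x - u) < e.
Proof.
move=> Sx e0; have eC : 0 < e%:C%C by rewrite ltcR.
have [u [Su]] := Sx _ (nbhsx_ballx x _ eC).
by rewrite -ball_normE /= rnormE ltcR => ue; exists u.
Qed.

Section Intertwining.
Context {R : realType} {A B : cstarAlgType R}.
Context {E : hilbertModType A} {F : hilbertModType B}.
Variable T : {linear E -> F}.
Implicit Types (a : A) (b : B) (x y : E).

(* The graph of the isomorphism to be constructed. *)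
Definition intertwines a b :=
  (forall x, T (act x a) = act (T x) b) /\
  (forall x, T (act x (cstar a)) = act (T x) (cstar b)).

Lemma intertwinesD a b a' b' :
  intertwines a b -> intertwines a' b' -> intertwines (a + a') (b + b').
Proof.
by move=> [h1 h2] [k1 k2]; split=> x; rewrite ?cstarD !actDr linearD ?h1 ?h2 ?k1 ?k2.
Qed.

Lemma intertwinesZ (c : R[i]) a b : intertwines a b -> intertwines (c *: a) (c *: b).
Proof.
by move=> [h1 h2]; split=> x; rewrite ?cstarZ !actZr linearZ /= ?h1 ?h2.
Qed.

Lemma intertwinesB a b a' b' :
  intertwines a b -> intertwines a' b' -> intertwines (a - a') (b - b').
Proof.
move=> ab /(intertwinesZ (-1)) ab'; rewrite -(scaleN1r a') -(scaleN1r b').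
exact: intertwinesD.
Qed.

(** The second clause of [intertwines] serves this purpose: the first does not visibly pass to
    adjoints while [T] is not known to respect inner products. *)
Lemma intertwines_star a b : intertwines a b -> intertwines (cstar a) (cstar b).
Proof. by move=> [h1 h2]; split=> x; rewrite ?cstarK. Qed.

Lemma intertwinesM a b a' b' :
  intertwines a b -> intertwines a' b' -> intertwines (cmul a a') (cmul b b').
Proof.
by move=> [h1 h2] [k1 k2]; split=> x; rewrite ?cstarM !actM ?k1 ?h1 ?h2 ?k2.
Qed.

Hypothesis T_iso : forall x, rnorm (T x) = rnorm x.

Lemma intertwines_lim (a_ : nat -> A) (b_ : nat -> B) (e : nat -> R) a b :
    vanishing e -> (forall n, intertwines (a_ n) (b_ n)) ->
    (forall n, rnorm (a - a_ n) <= e n) -> (forall n, rnorm (b - b_ n) <= e n) ->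
  intertwines a b.
Proof.
move=> e0 ab ae be.
have lim (u : nat -> A) (v : nat -> B) c d : (forall n x, T (act x (u n)) = act (T x) (v n)) ->
    (forall n, rnorm (c - u n) <= e n) -> (forall n, rnorm (d - v n) <= e n) ->
    forall x, T (act x c) = act (T x) d.
  move=> uv ue ve x; apply/eqP; rewrite -subr_eq0; apply/eqP; apply: rnorm_eq0.
  apply/le_anti; rewrite rnorm_ge0 andbT.
  apply: (vanishing_le0 (c := 2 * rnorm x) e0) => [|n]; first by rewrite mulr_ge0 ?rnorm_ge0.
  have -> : T (act x c) - act (T x) d = T (act x (c - u n)) - act (T x) (d - v n).
    by rewrite !actBr linearB /= uv opprB addrA subrK.
  apply: le_trans (rnormB _ _) _; rewrite T_iso.
  have := rnorm_act x (c - u n); have := rnorm_act (T x) (d - v n); rewrite T_iso.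
  have := ler_wpM2l (rnorm_ge0 x) (ue n); have := ler_wpM2l (rnorm_ge0 x) (ve n); lra.
split; first exact: lim (fun n => (ab n).1) ae be.
by apply: (lim (cstar \o a_) (cstar \o b_)) => [n|n|n] /=;
  rewrite -?cstarB ?rnorm_cstar //; exact: (ab n).2.
Qed.

(* A self-adjoint [h] in the closed span of the inner products satisfies
   [|h|^m <= |h|^m / 2 + K |g|^(m-1)], with [K] independent of [m = 2^k]. *)
Lemma intertwines_norm_sa (fullE : full E) h g : cstar h = h ->
  intertwines h g -> rnorm h <= rnorm g.
Proof.
move=> sh [hg _]; apply/ler_addgt0Pr => eps eps0; pose c := rnorm g + eps.
have gc : rnorm g <= c by rewrite lerDl ltW.
have c0 : 0 < c by rewrite ltr_wpDl ?rnorm_ge0.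
have [h0|h0] := leP (rnorm h) 0; first exact: le_trans h0 (ltW c0).
have : closure (lspan [set inner p.1 p.2 | p in [set: E * E]]) h by rewrite fullE.
move/closure_rnorm => /(_ _ (divr_gt0 h0 (ltr0Sn R 1)))[u [n [k [s [ss uE]]]] hu].
have [K K0 Kn] : exists2 K : R, 0 <= K &
    forall m, unorm (uinj u * uinj h ^+ m) <= K * c ^+ m.
  have {}ss i : exists q : E * E, s i = inner q.1 q.2.
    by have [q _ <-] := ss i; exists q.
  exists (\sum_i cabs (k i) * (rnorm (sval (cid (ss i))).1 * rnorm (sval (cid (ss i))).2)).
    by apply: sumr_ge0 => i _; rewrite !mulr_ge0 ?cabs_ge0 ?rnorm_ge0.
  move=> m; rewrite uE.
  (* Here [y = x h^m]. As [T y = (T x) g^m] and [T] is isometric, [g] controls its norm, although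
     [|h|] could a priori be larger. *)
  have actn x : exists2 y, rnorm y <= rnorm x * c ^+ m &
      forall z, uinj (inner z x) * uinj h ^+ m = uinj (inner z y).
    elim: m => [|m [y yc yE]]; first by exists x => [|z]; rewrite mulr1.
    exists (act y h) => [|z]; last by rewrite inner_actr uinjM -yE exprSr mulrA.
    rewrite -T_iso hg; apply: le_trans (rnorm_act _ _) _; rewrite T_iso exprSr mulrA.
    by rewrite ler_pM ?rnorm_ge0.
  elim/big_ind2: _ => [|a r b t ar bt|i _].
  - by rewrite -[uinj 0]/(0 : unitization A) !mul0r unorm0.
  - by rewrite uinjD mulrDl [in leRHS]mulrDl; apply: le_trans (unormD _ _) (lerD _ _).
  - case: (cid (ss i)) => q /= ->; have [y yc yE] := actn q.2.
    rewrite uinjZ -scalerAl yE; apply: le_trans (unormZ_le _ _) _.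
    rewrite unorm_inj -!mulrA ler_wpM2l ?cabs_ge0 //.
    by apply: le_trans (rnorm_inner_le _ _) _; rewrite ler_wpM2l ?rnorm_ge0.
apply: (@exp2_growth _ _ _ (2 * K)) => //; first by rewrite mulr_ge0.
move=> j; have := @unorm_exp2 _ _ (uinj h) j; rewrite ustar_inj sh unorm_inj => /(_ erefl).
have [m ->] : exists m, (2 ^ j = m.+1)%N by exists (2 ^ j).-1; rewrite prednK ?expn_gt0.
move=> hm; have hle : rnorm h ^+ m.+1 <= rnorm h ^+ m.+1 / 2 + K * c ^+ m.
  rewrite -{1}hm exprS -{1}(subrK u h) uinjD mulrDl.
  apply: le_trans (unormD _ _) (lerD _ (Kn m)).
  apply: le_trans (unormM _ _) _; rewrite unorm_inj exprS mulrAC.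
  rewrite ler_pM ?rnorm_ge0 ?unorm_ge0 ?(ltW hu) // -unorm_inj.
  elim: m {hm} => [|m IH]; first by rewrite !expr0 unorm1.
  by rewrite !exprS; apply: le_trans (unormM _ _) _; rewrite ler_wpM2l ?unorm_ge0.
rewrite -/c (exprS c m) -[leRHS]mulrA ler_wpM2l ?(ltW c0) //.
apply: le_trans (_ : c ^+ m * (2 * K) <= _); first by lra.
rewrite ler_wpM2l ?exprn_ge0 ?(ltW c0) //.
have := ler_peMl (_ : 0 <= 2 * K) (_ : 1 <= m.+1%:R :> R); rewrite mulr_ge0 // ler1n.
by move=> /(_ isT isT); lra.
Qed.

Lemma intertwines_norm_le (fullE : full E) a b :
  intertwines a b -> rnorm a <= rnorm b.
Proof.
move=> ab; rewrite -(@ler_pXn2r _ 2) ?nnegrE ?rnorm_ge0 // -!rnorm_cstar_cmul.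
apply: intertwines_norm_sa => //; first by rewrite cstarM cstarK.
exact: (intertwinesM (intertwines_star ab) ab).
Qed.

Hypothesis T_ternary : forall x y z,
  T (act x (inner y z)) = act (T x) (inner (T y) (T z)).

Lemma intertwines_inner x y : intertwines (inner x y) (inner (T x) (T y)).
Proof. by split=> z; rewrite ?inner_sym T_ternary. Qed.

(** Linear combinations of inner products have partners by [T_ternary]; for general [a], [le_ab]
    makes the partners of approximants a Cauchy sequence in [B]. *)
Lemma intertwines_ex (fullE : full E) :
    (forall a b, intertwines a b -> rnorm b <= rnorm a) ->
  forall a, exists b, intertwines a b.
Proof.
move=> le_ab a.
have span u : lspan [set inner p.1 p.2 | p in [set: E * E]]%classic u ->
    exists b, intertwines u b.
  move=> [n [k [s [ss ->]]]]; elim/big_ind: _ => [|u1 u2 [b1 h1] [b2 h2]|i _].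
  - by exists 0; split=> x; rewrite ?cstar0 !act0r linear0.
  - by exists (b1 + b2); exact: intertwinesD.
  - have [q _ <-] := ss i; exists (k i *: inner (T q.1) (T q.2)).
    exact/intertwinesZ/intertwines_inner.
pose e n : R := n.+1%:R^-1.
have e0 n : 0 < e n by rewrite invr_gt0 ltr0n.
have approx n : exists ub : A * B, intertwines ub.1 ub.2 /\ rnorm (a - ub.1) < e n.
  have : closure (lspan [set inner p.1 p.2 | p in [set: E * E]])%classic a by rewrite fullE.
  move/closure_rnorm => /(_ _ (e0 n))[u /span[b ub] ue].
  by exists (u, b).
pose f n := sval (cid (approx n)).
have fab n : intertwines (f n).1 (f n).2 := (svalP (cid (approx n))).1.
have fe n : rnorm (a - (f n).1) < e n := (svalP (cid (approx n))).2.
have e_le n m : (n <= m)%N -> e m <= e n.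
  by move=> nm; rewrite lef_pV2 ?posrE ?ltr0n // ler_nat.
have ve : vanishing (fun n => 2 * e n).
  move=> eps eps0; exists (Num.bound (2 / eps)); set n := Num.bound _.
  have : 2 / eps < n%:R by apply: Num.Theory.archi_boundP; rewrite divr_ge0 // ltW.
  rewrite ltr_pdivrMr // ltr_pdivrMr ?ltr0n // => lt; apply: lt_le_trans lt _.
  by rewrite mulrC ler_wpM2l ?(ltW eps0) // ler_nat.
have [|b fb] := rnorm_cauchy (u := fun n => (f n).2) ve.
  move=> n m nm; apply: le_trans (le_ab _ _ (intertwinesB (fab m) (fab n))) _.
  have -> : (f m).1 - (f n).1 = (a - (f n).1) - (a - (f m).1).
    by rewrite opprB [RHS]addrC subrKA.
  by apply: le_trans (rnormB _ _) _; have := fe n; have := fe m; have := e_le _ _ nm; lra.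
exists b; apply: (intertwines_lim ve fab) => // n.
by have := fe n; have := e0 n; lra.
Qed.

End Intertwining.

Section LinearInverse.
Context {R : realType} {E F : lmodType R[i]} (T : {linear E -> F}).

Lemma linear_inverse : injective T -> (forall y, exists x, T x = y) ->
  exists S : {linear F -> E}, cancel T S /\ cancel S T.
Proof.
move=> inj surj; pose S y := sval (cid (surj y)).
have SK : cancel S T by move=> y; exact: svalP (cid (surj y)).
have S_lin : linear S by move=> c x y; apply: inj; rewrite linearP !SK.
pose SL := GRing.isLinear.Build _ _ _ _ S S_lin.
pose S' : {linear F -> E} := HB.pack S SL.
by exists S'; split=> [x|y]; [apply: inj; exact: SK|exact: SK].
Qed.

End LinearInverse.

Theorem corollary10 (R : realType) (A B : cstarAlgType R)
    (E : hilbertModType A) (F : hilbertModType B)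
    (fullE : full E) (fullF : full F)
    (T : {linear E -> F})
    (surjT : forall y : F, exists x : E, T x = y)
    (isoT : n_isometry 2 T) :
  exists phi : {linear A -> B},
    [/\ star_isomorphism phi,
        forall x y : E, inner (T x) (T y) = phi (inner x y) &
        forall (x : E) (a : A), T (act x a) = act (T x) (phi a)].
Proof.
have T2_iso (x : (E * E)%type) : sqnorm2 (T x.1, T x.2) = sqnorm2 x.
  have := isoT (colmx2 x).
  have -> : map_mx T (colmx2 x) = colmx2 (T x.1, T x.2).
    by apply/matrixP => i j; rewrite !mxE; case: ifP; rewrite ?linear0 //; case: ifP.
  by rewrite !mxmodnorm_col => /eqP; rewrite eqr_sqrt ?sqnorm2_ge0 // => /eqP.
have T_iso x : rnorm (T x) = rnorm x.
  have := T2_iso (x, 0).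
  rewrite /sqnorm2 !inner2E /= linear0 !inner0r !addr0 !rnorm_inner => /eqP.
  by rewrite eqrXn2 ?rnorm_ge0 // => /eqP.
have T_inj : injective T.
  move=> x y xy; apply/eqP; rewrite -subr_eq0; apply/eqP/rnorm_eq0.
  by rewrite -T_iso linearB /= xy subrr rnorm0.
have [S [TK SK]] := linear_inverse T_inj surjT.
have S_iso y : rnorm (S y) = rnorm y by rewrite -{2}[y]SK T_iso.
have T_ternary := isometry_ternary SK T2_iso.
have S_ternary x y z : S (act x (inner y z)) = act (S x) (inner (S y) (S z)).
  by apply: T_inj; rewrite T_ternary !SK.
have swap a b : intertwines T a b -> intertwines S b a.
  by move=> [h1 h2]; split=> y; apply: T_inj; rewrite ?h1 ?h2 !SK.
have swap' b a : intertwines S b a -> intertwines T a b.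
  by move=> [h1 h2]; split=> y; rewrite -[LHS]SK -[RHS]SK; congr (T _); rewrite ?h1 ?h2 !TK.
have norm_ab a b : intertwines T a b -> rnorm a = rnorm b.
  move=> ab; apply/le_anti; rewrite (intertwines_norm_le T_iso fullE ab).
  by rewrite (intertwines_norm_le S_iso fullF (swap _ _ ab)).
have ex_b : forall a, exists b, intertwines T a b.
  by apply: intertwines_ex => // a b /norm_ab ->.
have ex_a b : exists a, intertwines T a b.
  have [|a ba] := intertwines_ex S_iso S_ternary fullF _ b; last by exists a; exact: swap'.
  by move=> c d /swap' /norm_ab ->.
(* The difference of two partners of [a] is a partner of 0, hence of norm 0. The algebraic
   properties of [phi] then follow from closure properties of its graph. *)
have unique_b a b b' : intertwines T a b -> intertwines T a b' -> b = b'.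
  move=> ab ab'; apply/eqP; rewrite -subr_eq0; apply/eqP/rnorm_eq0.
  by rewrite -(norm_ab _ _ (intertwinesB ab ab')) subrr rnorm0.
have unique_a a a' b : intertwines T a b -> intertwines T a' b -> a = a'.
  move=> ab ab'; apply/eqP; rewrite -subr_eq0; apply/eqP/rnorm_eq0.
  by rewrite (norm_ab _ _ (intertwinesB ab ab')) subrr rnorm0.
pose phi a := sval (cid (ex_b a)).
have phiP a : intertwines T a (phi a) := svalP (cid (ex_b a)).
have phi_lin : linear phi.
  by move=> c a a'; apply: unique_b (phiP _) _; apply: intertwinesD; [apply: intertwinesZ|].
pose phiL := GRing.isLinear.Build _ _ _ _ phi phi_lin.
pose phi' : {linear A -> B} := HB.pack phi phiL.
exists phi'; split=> [|x y|x a]; last exact: (phiP a).1.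
  split=> [|a b|a].
  - exists (fun b => sval (cid (ex_a b))) => [a|b].
      exact: unique_a (svalP (cid (ex_a _))) (phiP a).
    exact: unique_b (phiP _) (svalP (cid (ex_a b))).
  - exact: unique_b (phiP _) (intertwinesM (phiP a) (phiP b)).
  - exact: unique_b (phiP _) (intertwines_star (phiP a)).
exact: unique_b (intertwines_inner T_ternary x y) (phiP _).
Qed.
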